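(* Let $H_1,\dots,H_k$ be finite simple graphs, where $H_1$ is the complete graph on two vertices (a single edge) and each $H_i$ contains at least one edge. Let $\beta_1,\dots,\beta_k$ be real numbers such that $\beta_2,\dots,\beta_k$ are nonnegative. Let $T(h)=\sum_{i=1}^k\beta_i\,t(H_i,h)$ for $h\in\mathcal{W}$, and let $\psi_n=\frac{1}{n^2}\log\sum_{G\in\mathcal{G}_n}e^{n^2T(\widetilde{G})}$. Then $$\lim_{n\to\infty}\psi_n=\sup_{0\le u\le1}\Bigl(\sum_{i=1}^k\beta_iu^{e(H_i)}-I(u)\Bigr),$$ where $I(u)=\frac12u\log u+\frac12(1-u)\log(1-u)$ and $e(H_i)$ is the number of edges of $H_i$. Moreover, each solution $h$ of the variational problem of maximizing $T(h)-I(h)$ over $\mathcal{W}$ is (almost everywhere) a constant function, where the constant solves the scalar maximization problem on the right-hand side above.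
   Context: $\mathcal{G}_n$ is the set of all simple graphs (undirected, no loops, no multiple edges) on the vertex set $\{1,\dots,n\}$. $\mathcal{W}$ is the set of all measurable functions $h:[0,1]^2\to[0,1]$ with $h(x,y)=h(y,x)$. For a finite simple graph $H$ with vertex set $\{1,\dots,m\}$ and edge set $E(H)$, and $h\in\mathcal{W}$, $t(H,h)=\int_{[0,1]^m}\prod_{\{i,j\}\in E(H)}h(x_i,x_j)\,dx_1\cdots dx_m$. For a simple graph $G$ on $\{1,\dots,n\}$, $f^G\in\mathcal{W}$ is defined by $f^G(x,y)=1$ if $(\lceil nx\rceil,\lceil ny\rceil)$ is an edge of $G$ and $0$ otherwise. $T(\widetilde{G})$ means $T(f^G)$, i.e. $T(\widetilde{G})=\sum_{i=1}^k\beta_it(H_i,G)$, where $t(H,G)=|\hom(H,G)|/|V(G)|^{|V(H)|}=t(H,f^G)$ is the homomorphism density ($|\hom(H,G)|$ is the number of edge-preserving maps $V(H)\to V(G)$). For $h\in\mathcal{W}$, $I(h)=\iint_{[0,1]^2}I(h(x,y))\,dx\,dy$ with $I(u)$ as in the claim ($0\log0=0$). *)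

(* Defs.v *)
From HB Require Import structures.
From mathcomp Require Import all_boot all_order all_algebra.
From mathcomp Require Import all_classical all_reals all_analysis.

Set Implicit Arguments.
Unset Strict Implicit.
Unset Printing Implicit Defensive.

Import Order.TTheory GRing.Theory Num.Theory.
Import numFieldNormedType.Exports.

Local Open Scope classical_set_scope.
Local Open Scope ring_scope.

(* A simple graph on n vertices, given by its adjacency function. The vertex
   i : 'I_n stands for the vertex i + 1 of {1, ..., n}. *)

Definition simple_adj n (a : {ffun 'I_n * 'I_n -> bool}) : bool :=
  [forall i, ~~ a (i, i)] && [forall i, forall j, a (i, j) == a (j, i)].

Record sgraph (n : nat) := SGraph {
  adj : {ffun 'I_n * 'I_n -> bool};
  _ : simple_adj adj }.

HB.instance Definition _ n := [isSub for @adj n].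
HB.instance Definition _ n := [Equality of sgraph n by <:].
HB.instance Definition _ n := [Choice of sgraph n by <:].
HB.instance Definition _ n := [Countable of sgraph n by <:].
HB.instance Definition _ n := [Finite of sgraph n by <:].

(* Each undirected edge {i, j} is counted once, as the pair with i < j. *)
Definition edges n (G : sgraph n) : {set 'I_n * 'I_n} :=
  [set p : 'I_n * 'I_n | (p.1 < p.2)%N && adj G p].

Definition complete n (G : sgraph n) : Prop :=
  forall i j : 'I_n, adj G (i, j) = (i != j).

Section lebesgue_tuple.
Variable R : realType.
Local Notation M := (measurableTypeR R).

Definition cons_tup n (p : M * n.-tuple M) : n.+1.-tuple M :=
  [the n.+1.-tuple M of p.1 :: p.2].

Lemma measurable_cons_tup n : measurable_fun [set: M * n.-tuple M] (@cons_tup n).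
Proof.
exact: (@measurable_cons _ _ _ _ (fst : M * n.-tuple M -> M) n snd).
Qed.

(* The product of Lebesgue measure on R with mu, a measure on R^n, as a measure
   on R^(n + 1). *)
Definition lebesgue_cons n (mu : {sigma_finite_measure set (n.-tuple M) -> \bar R})
    : set (n.+1.-tuple M) -> \bar R :=
  pushforward (@lebesgue_measure R \x mu)%E (@cons_tup n).

Section lebesgue_cons_measure.
Variables (n : nat) (mu : {sigma_finite_measure set (n.-tuple M) -> \bar R}).

HB.instance Definition _ := Measure.copy (lebesgue_cons mu)
  (measure_function_pushforward__canonical__measure_function_Measure
     (@lebesgue_measure R \x mu)%E (@measurable_cons_tup n)).

Lemma lebesgue_cons_sigma_finite : sigma_finite setT (lebesgue_cons mu).
Proof.
pose uncons (x : n.+1.-tuple M) : M * n.-tuple M :=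
  (thead x, [tuple of behead x]).
have consK : cancel (@cons_tup n) uncons.
  by case=> x y; congr (_, _); apply/val_inj.
have munc : measurable_fun setT uncons.
  by apply/measurable_fun_pair;
    [exact: measurable_tnth|exact: measurable_behead].
have /sigma_finiteP[F [FT ndF Foo]] := sigma_finiteT (@lebesgue_measure R).
have /sigma_finiteP[G [GT ndG Goo]] := sigma_finiteT mu.
exists (fun k => uncons @^-1` (F k `*` G k)).
  rewrite -preimage_bigcup; apply/esym; rewrite -subTset => z _ /=.
  have : (\bigcup_i F i) (uncons z).1 by rewrite -FT.
  have : (\bigcup_i G i) (uncons z).2 by rewrite -GT.
  move=> [j _ Gj] [i _ Fi]; exists (maxn i j) => //; split.
    by move: Fi; exact/subsetPset/ndF/leq_maxl.
  by move: Gj; exact/subsetPset/ndG/leq_maxr.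
move=> k; have [mF Fk] := Foo k; have [mG Gk] := Goo k; split.
  by rewrite -[X in measurable X]setTI; apply: munc => //; exact: measurableX.
rewrite /lebesgue_cons /pushforward -comp_preimage.
rewrite (_ : _ \o _ = id); last by apply/funext => z; exact: consK.
by rewrite preimage_id product_measure1E// lte_mul_pinfty// ge0_fin_numE.
Qed.

HB.instance Definition _ := Measure_isSigmaFinite.Build _ _ _
  (lebesgue_cons mu) lebesgue_cons_sigma_finite.

End lebesgue_cons_measure.

Fixpoint lebesgue_tuple n : {sigma_finite_measure set (n.-tuple M) -> \bar R} :=
  match n with
  | 0%N => \d_([tuple] : 0.-tuple M)
  | n'.+1 => lebesgue_cons (lebesgue_tuple n')
  end.

End lebesgue_tuple.
Arguments lebesgue_tuple R n : clear implicits.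

Section graphons.
Variable R : realType.
Local Notation lebesgue2 := (@lebesgue_measure R \x @lebesgue_measure R)%E.

Definition unit_square : set (R * R) :=
  `[0, 1]%classic `*` `[0, 1]%classic.

Definition unit_cube n : set (n.-tuple (measurableTypeR R)) :=
  [set x | forall i, tnth x i \in `[0, 1]].

(* The space W. Functions on [0, 1]^2 are represented by functions on R^2
   whose values outside [0, 1]^2 are irrelevant. *)
Definition graphon : set (R * R -> R) :=
  [set h : R * R -> R | [/\ measurable_fun unit_square h,
      forall z, unit_square z -> 0 <= h z <= 1
    & forall x y, unit_square (x, y) -> h (x, y) = h (y, x)]].

Definition hom_density m (H : sgraph m) (h : R * R -> R) : R :=
  \int[lebesgue_tuple R m]_(x in @unit_cube m)
    \prod_(e in edges H) h (tnth x e.1, tnth x e.2).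

Definition graphon_of n (G : sgraph n) : R * R -> R := fun z =>
  [exists i : 'I_n, exists j : 'I_n,
     [&& Num.ceil (n%:R * z.1) == i.+1%:Z, Num.ceil (n%:R * z.2) == j.+1%:Z
       & adj G (i, j)]]%:R.

(* The library's ln vanishes at 0, so that 0 * ln 0 = 0. *)
Definition Iscalar (u : R) : R :=
  2^-1 * u * ln u + 2^-1 * (1 - u) * ln (1 - u).

Definition Igraphon (h : R * R -> R) : R :=
  \int[lebesgue2]_(z in unit_square) Iscalar (h z).

Section functional.
Variables (k : nat) (m : 'I_k -> nat) (H : forall i, sgraph (m i)).
Variable beta : 'I_k -> R.

Definition Tfun (h : R * R -> R) : R :=
  \sum_(i < k) beta i * hom_density (H i) h.

Definition psi (n : nat) : R :=
  (n%:R ^+ 2)^-1 *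
    ln (\sum_(G : sgraph n) expR (n%:R ^+ 2 * Tfun (graphon_of G))).

Definition scalar_fun (u : R) : R :=
  \sum_(i < k) beta i * u ^+ #|edges (H i)| - Iscalar u.

Definition scalar_solution (u : R) : Prop :=
  u \in `[0, 1] /\
  forall v, v \in `[0, 1] -> scalar_fun v <= scalar_fun u.

Definition graphon_solution (h : R * R -> R) : Prop :=
  graphon h /\
  forall g, graphon g ->
    Tfun g - Igraphon g <= Tfun h - Igraphon h.

End functional.

Definition ae_constant (h : R * R -> R) (u : R) : Prop :=
  {ae lebesgue2, forall z, unit_square z -> h z = u}.

End graphons.

(* Main.v *)
Require Import Defs.
From mathcomp Require Import all_boot all_order all_algebra.
From mathcomp Require Import all_classical all_reals all_analysis.
From mathcomp Require Import measurable_realfun.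
From mathcomp Require Import ring lra zify.

(** The scalar problem is the restriction of the variational problem for T - I
    to constant graphons, and the proof consists in showing that nothing is lost
    by this restriction.

    The key inequality is AM-GM: for a graph with e edges, the product of the
    values of h on the edges is at most the mean of their e-th powers, so the
    density of the graph in h is at most the integral of h ^ e. As only the
    coefficient of the single edge, for which this is an equality, may be
    negative, T(h) - I(h) is at most the integral of the scalar functional over
    the values of h, hence at most the scalar supremum.

    The upper bound for psi. By the weak regularity lemma ([weak_regularity]),
    every graph G on n vertices is close in cut norm, up to eps n^2, to its
    block averages h over a partition into boundedly many classes, and then
    T(G) is at most T(h) + O(eps) ([counting_lemma]). The partition and the
    block averages take exp(o(n^2)) values. For given ones, the law of the
    independent edges with probabilities h gives to each of the graphs
    concerned a weight at least exp(n^2 I(h)) ([edge_weight_block_avg]), so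
    there are at most exp(- n^2 I(h)) of them, and together they contribute at
    most exp(n^2 (T(h) - I(h) + O(eps))) to the partition function
    ([partition_function_le]).

    The lower bound for psi is the Gibbs variational principle applied to the
    random graph with independent edges of probability u: its entropy is
    - n^2 I(u) up to O(n), and the expected densities are u ^ e up to O(1/n)
    because almost all maps of vertices are injective
    ([partition_function_ge]).

    The maximizers. If h maximizes T - I then all the inequalities above are
    equalities. If some graph with at least two edges has a positive
    coefficient, equality in AM-GM makes h agree on two different edges at
    almost all points. Redrawing a vertex which belongs to only one of them
    shows that h(y, z) = h(y, t) for almost all y, z, t, so that the symmetric
    function h is constant ([hom_density_eq_mom], [symmetric_kernel_constant]).
    Otherwise the scalar functional is strictly concave, and almost all values
    of h are its unique maximum point ([scalar_fun_max_unique]). *)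

Set Implicit Arguments.
Unset Strict Implicit.
Unset Printing Implicit Defensive.

Import Order.TTheory GRing.Theory Num.Theory.
Import numFieldNormedType.Exports.

Local Open Scope classical_set_scope.
Local Open Scope ring_scope.

(** * The entropy function *)

Section entropy.
Variable R : realType.
Implicit Types u v w x y : R.

Lemma ln_le_subr1 x : 0 < x -> ln x <= x - 1.
Proof. by move=> x0; have := @le_ln1Dx _ (x - 1); rewrite [1 + _]addrC subrK; apply; lra. Qed.

Lemma ln_lt_subr1 x : 0 < x -> x != 1 -> ln x < x - 1.
Proof.
move=> x0 x1; rewrite -ltr_expR lnK//.
suff : 1 + (x - 1) < expR (x - 1) by rewrite [1 + _]addrC subrK.
by rewrite expR_gt1Dx// subr_eq0.
Qed.

(** The tangent line of x ln x at w: this is ln t <= t - 1 at t = w / x, and the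
    convention ln 0 = 0 covers x = 0. *)
Lemma mulr_ln_tangent w x : 0 < w -> 0 <= x -> x * ln w + (x - w) <= x * ln x.
Proof.
move=> w0; rewrite le_eqVlt => /orP[/eqP<-|x0]; first by rewrite !mul0r; lra.
have : ln (w / x) <= w / x - 1 by rewrite ln_le_subr1// divr_gt0.
rewrite ln_div// -(ler_pM2l x0) mulrBr mulrBr mulr1 mulrCA divff ?gt_eqF// mulr1; lra.
Qed.

Lemma mulr_ln_tangent_lt w x : 0 < w -> 0 < x -> x != w ->
  x * ln w + (x - w) < x * ln x.
Proof.
move=> w0 x0 xw.
have : ln (w / x) < w / x - 1.
  rewrite ln_lt_subr1// ?divr_gt0//; apply: contra xw => /eqP wx.
  by rewrite -[X in X == _]mul1r -wx divfK// gt_eqF.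
rewrite ln_div// -(ltr_pM2l x0) mulrBr mulrBr mulr1 mulrCA divff ?gt_eqF// mulr1; lra.
Qed.

Lemma Iscalar_le0 u : 0 <= u <= 1 -> Iscalar u <= 0.
Proof.
move=> /andP[u0 u1]; rewrite /Iscalar -!mulrA -mulrDr pmulr_rle0//.
have := @ln_le0 R u u1; have : ln (1 - u) <= 0 by apply: ln_le0; lra.
by move=> a b; rewrite -oppr_ge0 opprD -!mulrN addr_ge0// mulr_ge0//; lra.
Qed.

Lemma Iscalar_ge u : 0 <= u <= 1 -> - 2^-1 <= Iscalar u.
Proof.
move=> /andP[u0 u1]; rewrite /Iscalar.
have := @mulr_ln_tangent 1 u ltr01 u0.
have : 0 <= 1 - u by lra.
by move=> /(mulr_ln_tangent ltr01); rewrite ln1; lra.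
Qed.

(** The strict tangent line inequality is only available at positive points; it
    is used at the larger of u and v, and only for the term in x ln x. *)
Lemma Iscalar_midpoint u v : 0 <= u <= 1 -> 0 <= v <= 1 -> u != v ->
  Iscalar ((u + v) / 2) < (Iscalar u + Iscalar v) / 2.
Proof.
move=> u01 v01; wlog: u v u01 v01 / u < v.
  move=> H; have [uv _|vu _|] := ltgtP u v; last by [].
    by apply: H => //; lra.
  by rewrite addrC [X in _ < X / _]addrC; apply: H => //; lra.
move=> uv _; set w := (u + v) / 2.
have w0 : 0 < w by rewrite /w; lra.
have w1 : 0 < 1 - w by rewrite /w; lra.
have vw : v != w by rewrite /w; lra.
have /(mulr_ln_tangent w0) h1 : 0 <= u by lra.
have h2 : v * ln w + (v - w) < v * ln v by apply: mulr_ln_tangent_lt => //; lra.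
have /(mulr_ln_tangent w1) h3 : 0 <= 1 - u by lra.
have /(mulr_ln_tangent w1) h4 : 0 <= 1 - v by lra.
rewrite /Iscalar -/w.
have e1 : w * ln w = 2^-1 * (u * ln w + v * ln w) by rewrite /w; ring.
have e2 : (1 - w) * ln (1 - w) = 2^-1 * ((1 - u) * ln (1 - w) + (1 - v) * ln (1 - w)).
  by rewrite {1}/w; field.
rewrite -!(mulrA 2^-1) e1 e2; rewrite /w in h1 h2 h3 h4 *; lra.
Qed.

End entropy.

(** * Homomorphism densities of weighted graphs on n vertices *)

Section homomorphism_density.
Variables (R : realFieldType) (n : nat).
Implicit Types (m : nat).

Definition upd m (f : {ffun 'I_m -> 'I_n}) (p : 'I_m) (x : 'I_n) :
  {ffun 'I_m -> 'I_n} := [ffun i => if i == p then x else f i].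

(** Exchanging the new value x with the old value f p is an involution, so redrawing
    the image of a vertex preserves the uniform law on maps. *)
Lemma sum_upd m (p : 'I_m) (G : {ffun 'I_m -> 'I_n} -> R) :
  \sum_f \sum_x G (upd f p x) = n%:R * \sum_f G f.
Proof.
rewrite pair_big/=.
pose s (z : {ffun 'I_m -> 'I_n} * 'I_n) := (upd z.1 p z.2, z.1 p).
have sK : involutive s.
  case=> f x; rewrite /s/=; congr (_, _); last by rewrite ffunE eqxx.
  by apply/ffunP => i; rewrite !ffunE; case: eqP => // ->.
rewrite (reindex_inj (inv_inj sK))/=.
rewrite (eq_bigr (fun z => G z.1)); last first.
  move=> [f x] _; congr G; apply/ffunP => i; rewrite !ffunE/=.
  by case: eqP => // ->.
rewrite -(pair_big xpredT xpredT (fun f _ => G f))/= exchange_big/=.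
by rewrite sumr_const card_ord mulr_natl.
Qed.

Lemma sum_upd2 m (p q : 'I_m) (G : {ffun 'I_m -> 'I_n} -> R) :
  \sum_f \sum_x \sum_y G (upd (upd f p x) q y) = n%:R ^+ 2 * \sum_f G f.
Proof.
rewrite (sum_upd p (fun f => \sum_y G (upd f q y))) sum_upd; ring.
Qed.

Lemma sum_ffun2 m (p q : 'I_m) (w : 'I_n -> 'I_n -> R) : p != q ->
  n%:R ^+ 2 * \sum_(f : {ffun 'I_m -> 'I_n}) w (f p) (f q) =
  n%:R ^+ m * \sum_x \sum_y w x y.
Proof.
move=> pq; rewrite -(sum_upd2 p q).
under eq_bigr => f _ do under eq_bigr => x _ do under eq_bigr => y _ do
  rewrite !ffunE (negbTE pq) !eqxx.
by rewrite sumr_const card_ffun !card_ord -[LHS]mulr_natl natrX.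
Qed.

(** Each edge carries its own weight function, so that one weight can be replaced
    by another one edge at a time. *)
Definition hom_sum m (H : sgraph m) (w : 'I_m * 'I_m -> 'I_n -> 'I_n -> R) : R :=
  \sum_(f : {ffun 'I_m -> 'I_n}) \prod_(e in edges H) w e (f e.1) (f e.2).

Definition fin_density m (H : sgraph m) (w : 'I_n -> 'I_n -> R) : R :=
  (n%:R ^+ m)^-1 * hom_sum H (fun=> w).

Lemma prod01 (I : finType) (P : pred I) (F : I -> R) :
  (forall i, 0 <= F i <= 1) -> 0 <= \prod_(i | P i) F i <= 1.
Proof.
move=> F01; apply/andP; split; last by apply: prodr_ile1 => i _; exact: F01.
by apply: prodr_ge0 => i _; have /andP[] := F01 i.
Qed.

(** A one-sided bound on the cut norm. It is stated for weights instead of sets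
    because the other factors of a homomorphism product are weights; see
    [cut_le_sets]. *)
Definition cut_le (M : 'I_n -> 'I_n -> R) (eps : R) :=
  forall a b : 'I_n -> R, (forall x, 0 <= a x <= 1) -> (forall y, 0 <= b y <= 1) ->
  \sum_x \sum_y M x y * (a x * b y) <= eps * n%:R ^+ 2.

Lemma edgesP m (H : sgraph m) e : e \in edges H -> (e.1 < e.2)%N.
Proof. by rewrite inE => /andP[]. Qed.

(** When all the vertices but the two ends p and q of an edge are fixed, the other
    factors of the product split into a function of the image of p and a function
    of the image of q, because the graph has no other edge between p and q. *)
Lemma hom_sum_cut_le m (H : sgraph m) (w : 'I_m * 'I_m -> 'I_n -> 'I_n -> R)
    (M : 'I_n -> 'I_n -> R) eps e :
  (forall e x y, 0 <= w e x y <= 1) -> cut_le M eps -> e \in edges H ->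
  \sum_(f : {ffun 'I_m -> 'I_n})
    M (f e.1) (f e.2) * \prod_(d in edges H | d != e) w d (f d.1) (f d.2)
    <= eps * n%:R ^+ m.
Proof.
move=> w01 Mcut eH.
case: e eH => p q pqH; have := edgesP pqH; rewrite /= => pq.
have [n0|n0] := posnP n.
  rewrite big1; last first.
    by move=> f _; exfalso; have := leq_ltn_trans (leq0n _) (ltn_ord (f p)); rewrite n0.
  by rewrite n0 expr0n/= (gtn_eqF (leq_ltn_trans _ (ltn_ord p)))// mulr0.
have n2 : 0 < n%:R ^+ 2 :> R by rewrite exprn_gt0// ltr0n.
rewrite -(ler_pM2l n2) -(sum_upd2 p q).
rewrite mulrA (mulrC _ eps).
have -> : n%:R ^+ m = #|{: {ffun 'I_m -> 'I_n}}|%:R :> R.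
  by rewrite card_ffun !card_ord natrX.
rewrite mulr_natr -sumr_const; apply: ler_sum => f _.
(* the factors which depend on the image of q; they do not involve p *)
pose uses (d : 'I_m * 'I_m) := (d.1 == q) || (d.2 == q).
pose a x := \prod_(d in edges H | (d != (p, q)) && ~~ uses d)
  w d (upd f p x d.1) (upd f p x d.2).
pose b y := \prod_(d in edges H | (d != (p, q)) && uses d)
  w d (upd f q y d.1) (upd f q y d.2).
apply: (le_trans _ (Mcut a b _ _)); last 2 first.
- by move=> x; exact: prod01.
- by move=> y; exact: prod01.
rewrite le_eqVlt; apply/orP; left; apply/eqP; apply: eq_bigr => x _; apply: eq_bigr => y _.
have qp : (q == p) = false by apply/eqP => qp; rewrite qp ltnn in pq.
rewrite !ffunE !eqxx eq_sym qp; congr (_ * _).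
rewrite (bigID uses)/= mulrC; congr (_ * _).
  apply: eq_big => [d|d]; first by rewrite andbA.
  rewrite /uses negb_or => /andP[_ /andP[d1 d2]].
  by rewrite !ffunE (negbTE d1) (negbTE d2).
apply: eq_big => [d|[d1 d2]]; first by rewrite andbA.
rewrite /uses/= => /andP[/andP[dH dpq] /orP du].
have d12 := edgesP dH; rewrite /= in d12.
suff [d1p d2p] : d1 != p /\ d2 != p.
  by rewrite !ffunE (negbTE d1p) (negbTE d2p).
split; apply/eqP => dp; subst p.
  case: du => /eqP du; subst q; first by rewrite ltnn in pq.
  by rewrite eqxx in dpq.
case: du => /eqP du; subst q; last by rewrite ltnn in pq.
by have := ltn_trans pq d12; rewrite ltnn.
Qed.

(** The weights A are replaced by B one edge at a time, each replacement costing at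
    most eps n^m. *)
Lemma counting_lemma m (H : sgraph m) (A B : 'I_n -> 'I_n -> R) eps :
  (forall x y, 0 <= A x y <= 1) -> (forall x y, 0 <= B x y <= 1) ->
  cut_le (fun x y => A x y - B x y) eps -> (0 < n)%N ->
  fin_density H A <= fin_density H B + #|edges H|%:R * eps.
Proof.
move=> A01 B01 cutAB n0.
(* the edges in S still carry the weight A *)
pose w (S : {set 'I_m * 'I_m}) e := if e \in S then A else B.
have w01 S e x y : 0 <= w S e x y <= 1 by rewrite /w; case: ifP.
have step (S : {set 'I_m * 'I_m}) : S \subset edges H ->
    hom_sum H (w S) <= hom_sum H (fun=> B) + #|S|%:R * (eps * n%:R ^+ m).
  elim: {S}#|S| {-2}S (erefl #|S|) => [|k IH] S Sk SH.
    rewrite Sk mul0r addr0 (cards0_eq Sk) le_eqVlt; apply/orP; left; apply/eqP.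
    by apply: eq_bigr => f _; apply: eq_bigr => e _; rewrite /w inE.
  have /card_gt0P[e eS] : (0 < #|S|)%N by rewrite Sk.
  have eH := fintype.subsetP SH _ eS.
  have := hom_sum_cut_le (w01 (S :\ e)) cutAB eH.
  have Sek : #|S :\ e| = k by move: Sk; rewrite (cardsD1 e) eS => -[].
  have := IH _ Sek (fintype.subset_trans (finset.subsetDl _ _) SH).
  rewrite Sek => h1 h2.
  rewrite Sk -addn1 natrD mulrDl mul1r addrA.
  apply: (le_trans _ (lerD h1 h2)); rewrite /hom_sum -big_split/=.
  rewrite le_eqVlt; apply/orP; left; apply/eqP; apply: eq_bigr => f _.
  rewrite (bigD1 e)//= [X in _ = X + _](bigD1 e)//= {1 3}/w !inE eS eqxx/=.
  rewrite -mulrDl addrC subrK; congr (_ * _); apply: eq_bigr => d /andP[_ de].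
  by rewrite /w !inE de.
rewrite /fin_density.
have nm0 : 0 < n%:R ^+ m :> R by rewrite exprn_gt0// ltr0n.
rewrite ler_pdivrMl// mulrDr mulVKf ?gt_eqF// mulrCA.
have := step _ (subxx (edges H)); rewrite [eps * _]mulrC.
suff -> : hom_sum H (w (edges H)) = hom_sum H (fun=> A) by [].
by apply: eq_bigr => f _; apply: eq_bigr => e eH; rewrite /w eH.
Qed.

(** This is AM-GM for the numbers E i ^+ #|A|, whose geometric mean is the product of
    the E i. *)
Lemma leif_prod_mean_powers (I : finType) (A : {set I}) (E : I -> R) :
  (0 < #|A|)%N -> (forall i, 0 <= E i) ->
  \prod_(i in A) E i <= (\sum_(i in A) E i ^+ #|A|) / #|A|%:R
    ?= iff [forall i in A, forall j in A, E i == E j].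
Proof.
move=> A0 E0; have := @leif_AGM R I (mem A) (fun i => E i ^+ #|A|).
have -> : #|mem A| = #|A| by apply: eq_card.
case=> /= [i _|h1 h2]; first exact: exprn_ge0.
have s0 : 0 <= (\sum_(i in A) E i ^+ #|A|) / #|A|%:R.
  by rewrite divr_ge0// sumr_ge0// => i _; exact: exprn_ge0.
have p0 : 0 <= \prod_(i in A) E i by exact: prodr_ge0.
split; first by move: h1; rewrite prodrXl ler_pXn2r.
move: h2; rewrite prodrXl eqrXn2//= => ->.
apply: eq_forallb_in => i _; apply: eq_forallb_in => j _.
by rewrite eqrXn2.
Qed.

(** The mean of the e-th powers over the edges has the same expectation as a single
    e-th power, since an edge is mapped to a uniformly random pair. *)
Lemma fin_density_le m (H : sgraph m) (w : 'I_n -> 'I_n -> R) :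
  (0 < n)%N -> (0 < #|edges H|)%N -> (forall x y, 0 <= w x y) ->
  fin_density H w <= (n%:R ^+ 2)^-1 * \sum_x \sum_y w x y ^+ #|edges H|.
Proof.
move=> n0 E0 w0.
have nk k : 0 < n%:R ^+ k :> R by rewrite exprn_gt0// ltr0n.
rewrite ler_pdivlMl// mulrCA ler_pdivrMl// /hom_sum mulr_sumr.
pose t := \sum_(f : {ffun 'I_m -> 'I_n}) n%:R ^+ 2 *
  ((\sum_(e in edges H) w (f e.1) (f e.2) ^+ #|edges H|) / #|edges H|%:R).
apply: (@le_trans _ _ t).
  apply: ler_sum => f _; rewrite ler_pM2l//.
  by have [] := @leif_prod_mean_powers _ (edges H) (fun e => w (f e.1) (f e.2)) E0 (fun=> w0 _ _).
rewrite /t -mulr_sumr -mulr_suml mulrA exchange_big/= mulr_sumr.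
rewrite (eq_bigr (fun=> n%:R ^+ m * \sum_x \sum_y w x y ^+ #|edges H|)); last first.
  move=> e eH; rewrite (sum_ffun2 (fun x y => w x y ^+ #|edges H|))//.
  by apply: contraTneq (edgesP eH) => ->; rewrite ltnn.
by rewrite sumr_const -[X in X / _]mulr_natr mulfK// pnatr_eq0 -lt0n.
Qed.

Lemma fin_density_edge m (H : sgraph m) (w : 'I_n -> 'I_n -> R) :
  (0 < n)%N -> #|edges H| = 1%N ->
  fin_density H w = (n%:R ^+ 2)^-1 * \sum_x \sum_y w x y.
Proof.
move=> n0 /eqP/cards1P[e eE].
have nk k : n%:R ^+ k != 0 :> R by rewrite expf_neq0// pnatr_eq0 -lt0n.
have epq : e.1 != e.2.
  have /edgesP : e \in edges H by rewrite eE inE.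
  by apply: contraTneq => ->; rewrite ltnn.
rewrite /fin_density /hom_sum.
under eq_bigr do rewrite eE big_set1.
apply: (mulfI (nk 2%N)); rewrite mulrCA (sum_ffun2 _ epq) mulrA mulVf// mul1r.
by rewrite mulrA mulfV// mul1r.
Qed.

End homomorphism_density.

(** * Averages over the classes of a partition *)

Section class_average.
Variables (R : realFieldType) (I : finType).
Implicit Types (F g : I -> R).

Definition fiber_avg (T : eqType) (C : I -> T) F (z : I) : R :=
  (\sum_(w | C w == C z) F w) / #|[pred w | C w == C z]|%:R.

Lemma fiber_card_neq0 (T : eqType) (C : I -> T) z :
  #|[pred w | C w == C z]|%:R != 0 :> R.
Proof. by rewrite pnatr_eq0 -lt0n; apply/card_gt0P; exists z; rewrite inE. Qed.

Lemma eq_fiber_avg (T : eqType) (C : I -> T) F z w :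
  C z = C w -> fiber_avg C F z = fiber_avg C F w.
Proof. by rewrite /fiber_avg => ->. Qed.

Lemma fiber_avg01 (T : eqType) (C : I -> T) F :
  (forall z, 0 <= F z <= 1) -> forall z, 0 <= fiber_avg C F z <= 1.
Proof.
move=> F01 z; have c0 := fiber_card_neq0 C z.
have cgt0 : 0 < #|[pred w | C w == C z]|%:R :> R by rewrite lt0r c0 ler0n.
apply/andP; split.
  by rewrite divr_ge0// sumr_ge0// => w _; have /andP[] := F01 w.
rewrite ler_pdivrMr// mul1r -sumr_const; apply: ler_sum => w _.
by have /andP[] := F01 w.
Qed.

(** Averaging is self-adjoint and fixes the functions which are constant on the
    classes. *)
Lemma sum_fiber_avg (T : eqType) (C : I -> T) F g :
  (forall z w, C z = C w -> g z = g w) ->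
  \sum_z fiber_avg C F z * g z = \sum_z F z * g z.
Proof.
move=> gC.
under eq_bigr do rewrite /fiber_avg mulrAC big_distrl/= big_distrl/=.
rewrite (exchange_big_dep xpredT)//=; apply: eq_bigr => w _.
rewrite (eq_bigr (fun=> F w * g w / #|[pred z | C z == C w]|%:R)); last first.
  by move=> z /eqP Cwz; rewrite (gC _ _ Cwz) Cwz.
rewrite (eq_bigl [pred z | C z == C w]); last by move=> z; rewrite inE eq_sym.
by rewrite sumr_const -[LHS]mulr_natr divfK// fiber_card_neq0.
Qed.

(** The average over C is the orthogonal projection of the average over the finer
    partition C', so the difference of the two is orthogonal to the former. *)
Lemma fiber_avg_pythagoras (T T' : eqType) (C : I -> T) (C' : I -> T') F :
  (forall z w, C' z = C' w -> C z = C w) ->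
  \sum_z fiber_avg C' F z ^+ 2 = \sum_z fiber_avg C F z ^+ 2 +
    \sum_z (fiber_avg C' F z - fiber_avg C F z) ^+ 2.
Proof.
move=> C'C.
have h1 := @sum_fiber_avg _ C' F (fiber_avg C F) (fun z w zw => eq_fiber_avg F (C'C _ _ zw)).
have h2 := @sum_fiber_avg _ C F (fiber_avg C F) (@eq_fiber_avg _ C F).
apply/eqP; rewrite -subr_eq0 -big_split/= -sumrB.
rewrite (eq_bigr (fun z => fiber_avg C' F z * fiber_avg C F z * 2 -
  fiber_avg C F z * fiber_avg C F z * 2)); last by move=> z _; ring.
by rewrite sumrB -!mulr_suml h1 h2 subrr.
Qed.

End class_average.

(** * The weak regularity lemma *)

Section weak_regularity.
Variables (R : realFieldType) (n : nat).
Implicit Types (A M : 'I_n -> 'I_n -> R).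

Definition block_avg (T : eqType) (c : 'I_n -> T) A x y : R :=
  fiber_avg (fun z => (c z.1, c z.2)) (fun z => A z.1 z.2) (x, y).

Lemma block_avg01 (T : eqType) (c : 'I_n -> T) A :
  (forall x y, 0 <= A x y <= 1) -> forall x y, 0 <= block_avg c A x y <= 1.
Proof. by move=> A01 x y; apply: fiber_avg01 => -[? ?]. Qed.

Lemma sum_block_avg (T : eqType) (c : 'I_n -> T) A (g : 'I_n -> 'I_n -> R) :
  (forall x y x' y', c x = c x' -> c y = c y' -> g x y = g x' y') ->
  \sum_x \sum_y block_avg c A x y * g x y = \sum_x \sum_y A x y * g x y.
Proof.
move=> gc; rewrite !pair_big/=.
have := @sum_fiber_avg R _ _ (fun z : 'I_n * 'I_n => (c z.1, c z.2))
  (fun z => A z.1 z.2) (fun z => g z.1 z.2).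
rewrite /block_avg => <-; last by move=> [x y] [x' y'] /= [? ?]; exact: gc.
by apply: eq_bigr => -[x y].
Qed.

(** For fixed b the sum is linear in a, so it is largest when a is the indicator of
    the set where its coefficient is positive; then the same holds for b. *)
Lemma cut_le_sets M eps :
  (forall X Y : {set 'I_n},
     \sum_x \sum_y M x y * ((x \in X)%:R * (y \in Y)%:R) <= eps * n%:R ^+ 2) ->
  cut_le M eps.
Proof.
move=> Mset a b a01 b01.
have pick (s u : R) : 0 <= u <= 1 -> s * u <= s * (0 < s)%R%:R.
  move=> /andP[u0 u1]; have [s0|s0] := ltP 0 s.
    by rewrite ler_pM2l.
  by rewrite mulr0 mulr_le0_ge0.
pose X := [set x | 0 < \sum_y M x y * b y]%SET.
pose Y := [set y | 0 < \sum_x M x y * (x \in X)%:R]%SET.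
apply: le_trans (Mset X Y).
apply: (@le_trans _ _ (\sum_x \sum_y M x y * ((x \in X)%:R * b y))).
  apply: ler_sum => x _.
  rewrite (eq_bigr (fun y => M x y * b y * a x)); last by move=> y _; ring.
  rewrite [leRHS](eq_bigr (fun y => M x y * b y * (x \in X)%:R)); last by move=> y _; ring.
  by rewrite -!mulr_suml inE; exact: pick.
rewrite exchange_big [leRHS]exchange_big/=; apply: ler_sum => y _.
rewrite (eq_bigr (fun x => M x y * (x \in X)%:R * b y)); last by move=> x _; ring.
rewrite [leRHS](eq_bigr (fun x => M x y * (x \in X)%:R * (y \in Y)%:R)); last by move=> x _; ring.
by rewrite -!mulr_suml [y \in Y]inE; exact: pick.
Qed.

Definition energy (T : eqType) (c : 'I_n -> T) A :=
  \sum_z block_avg c A z.1 z.2 ^+ 2.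

Lemma energy_le (T : eqType) (c : 'I_n -> T) A :
  (forall x y, 0 <= A x y <= 1) -> energy c A <= n%:R ^+ 2.
Proof.
move=> A01; have -> : n%:R ^+ 2 = #|{: 'I_n * 'I_n}|%:R :> R.
  by rewrite card_prod !card_ord natrM.
rewrite -sumr_const; apply: ler_sum => z _.
by have /andP[? ?] := block_avg01 c A01 z.1 z.2; rewrite exprn_ile1.
Qed.

Definition refine (T : eqType) (c : 'I_n -> T) (X Y : {set 'I_n}) x : T * (bool * bool) :=
  (c x, (x \in X, x \in Y)).

(** The product of X and Y is a union of classes of the refined partition, so in
    its sum A can be replaced by the refined average. The difference d of the two
    averages satisfies d <= d^2 / (2 eps) + eps / 2, so a large sum of d forces a
    large sum of d^2, which is the gain of energy. *)
Lemma energy_increment (T : eqType) (c : 'I_n -> T) A eps (X Y : {set 'I_n}) : 0 < eps ->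
  eps * n%:R ^+ 2 <
    \sum_x \sum_y (A x y - block_avg c A x y) * ((x \in X)%:R * (y \in Y)%:R) ->
  energy c A + eps ^+ 2 * n%:R ^+ 2 <= energy (refine c X Y) A.
Proof.
move=> eps0 irr; set c' := refine c X Y.
rewrite {2}/energy.
pose C z : T * T := (c z.1, c z.2).
pose C' z := (c' z.1, c' z.2).
pose F z := A z.1 z.2.
have C'C z w : C' z = C' w -> C z = C w by rewrite /C'/C/c'/refine => -[-> _ _ -> _ _].
have pyth := fiber_avg_pythagoras F C'C.
rewrite (_ : \sum_z _ = \sum_z fiber_avg C' F z ^+ 2); last by apply: eq_bigr => -[].
rewrite pyth (_ : energy c A = \sum_z fiber_avg C F z ^+ 2); last by apply: eq_bigr => -[].
rewrite lerD2l.
pose d z := fiber_avg C' F z - fiber_avg C F z.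
pose k (z : 'I_n * 'I_n) : R := (z.1 \in X)%:R * (z.2 \in Y)%:R.
have kC' z w : C' z = C' w -> k z = k w.
  by rewrite /C'/k/c'/refine => -[_ -> _ _ _ ->].
have e1 : eps * n%:R ^+ 2 < \sum_z d z * k z.
  apply: lt_le_trans irr _; rewrite le_eqVlt; apply/orP; left; apply/eqP.
  rewrite pair_big/=.
  transitivity (\sum_z F z * k z - \sum_z fiber_avg C F z * k z).
    by rewrite -sumrB; apply: eq_bigr => -[x y] _; rewrite mulrBl.
  by rewrite -(sum_fiber_avg F kC') -sumrB; apply: eq_bigr => z _; rewrite mulrBl.
have e2 : \sum_z d z * k z <= \sum_z (d z ^+ 2 / (2 * eps) + eps / 2).
  apply: ler_sum => z _; rewrite -(ler_pM2l (_ : 0 < 2 * eps)); last by rewrite mulr_gt0.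
  have -> : 2 * eps * (d z ^+ 2 / (2 * eps) + eps / 2) = d z ^+ 2 + eps ^+ 2.
    by field; rewrite gt_eqF.
  have [->|->] : k z = 1 \/ k z = 0.
  - by rewrite /k; do 2 case: (_ \in _); rewrite ?mulr1 ?mulr0 ?mul0r; auto.
  - by have := sqr_ge0 (d z - eps); nra.
  - by rewrite !mulr0 addr_ge0// sqr_ge0.
have := lt_le_trans e1 e2; rewrite big_split/= -mulr_suml sumr_const card_prod !card_ord.
rewrite -[_ *+ (n * n)]mulr_natr natrM -expr2 => e3.
have : (eps * n%:R ^+ 2 - eps / 2 * n%:R ^+ 2) * (2 * eps) < (\sum_i d i ^+ 2 / (2 * eps)) * (2 * eps).
  rewrite ltr_pM2r ?mulr_gt0// -mulr_suml; lra.
rewrite -mulr_suml divfK ?mulf_neq0 ?gt_eqF//; rewrite /d => e4; apply: ltW.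
by apply: le_lt_trans e4; rewrite le_eqVlt; apply/orP; left; apply/eqP; field.
Qed.

(** Only the partition matters, not the names of its classes. *)
Lemma eq_block_avg (T T' : eqType) (c : 'I_n -> T) (c' : 'I_n -> T') A :
  (forall x y, (c x == c y) = (c' x == c' y)) -> block_avg c A = block_avg c' A.
Proof.
move=> cc'; apply/funext => x; apply/funext => y; rewrite /block_avg /fiber_avg.
congr (_ / _%:R); last by apply: eq_card => z; rewrite !inE !xpair_eqE !cc'.
by apply: eq_bigl => z; rewrite !xpair_eqE !cc'.
Qed.

(** While the partition is not regular, refining it increases the energy by
    eps^2 n^2; as the energy is at most n^2 this stops within r steps, each of
    which multiplies the number of classes by 4. *)
Lemma weak_regularity r A eps : 0 < eps -> 1 < r%:R * eps ^+ 2 -> (0 < n)%N ->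
  (forall x y, 0 <= A x y <= 1) ->
  exists c : {ffun 'I_n -> 'I_(4 ^ r)},
    cut_le (fun x y => A x y - block_avg c A x y) eps.
Proof.
move=> eps0 reps n0 A01.
suff [c [cr creg]] : exists c : 'I_n -> nat, (forall x, c x < 4 ^ r)%N /\
    cut_le (fun x y => A x y - block_avg c A x y) eps.
  exists [ffun x => Ordinal (cr x)].
  by rewrite -(@eq_block_avg _ _ c)// => x y; rewrite !ffunE.
apply: contrapT => noreg.
suff [c [_]] : exists c : 'I_n -> nat, (forall x, c x < 4 ^ r)%N /\
    r%:R * eps ^+ 2 * n%:R ^+ 2 <= energy c A.
  move=> /le_trans/(_ (energy_le c A01)); rewrite leNgt => /negP[].
  by rewrite ltr_pMl// exprn_gt0// ltr0n.
suff: forall k, (k <= r)%N -> exists c : 'I_n -> nat, (forall x, c x < 4 ^ k)%N /\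
    k%:R * eps ^+ 2 * n%:R ^+ 2 <= energy c A by exact.
elim=> [_|k IH kr].
  exists (fun=> 0%N); split=> //.
  by rewrite !mul0r; apply: sumr_ge0 => z _; exact: sqr_ge0.
have [c [ck cE]] := IH (ltnW kr).
have [X [Y XY]] : exists X Y : {set 'I_n}, eps * n%:R ^+ 2 <
    \sum_x \sum_y (A x y - block_avg c A x y) * ((x \in X)%:R * (y \in Y)%:R).
  apply: contrapT => nXY; apply: noreg; exists c; split.
    by move=> x; apply: leq_trans (ck x) _; rewrite leq_exp2l// ltnW.
  apply: cut_le_sets => X Y.
  by rewrite leNgt; apply/negP => XY; apply: nXY; exists X, Y.
have H := energy_increment eps0 XY.
(* an encoding by numbers of the refined partition *)
exists (fun x => 4 * c x + 2 * (x \in X) + (x \in Y))%N; split.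
  by move=> x; have := ck x; rewrite expnS; case: (x \in X); case: (x \in Y); lia.
apply: (@le_trans _ _ (energy (refine c X Y) A)).
  apply: le_trans H; rewrite -addn1 natrD !mulrDl mul1r; exact: lerD.
rewrite /energy (@eq_block_avg _ _ (refine c X Y) (fun x => 4 * c x + 2 * (x \in X) + (x \in Y))%N)//.
move=> x y; rewrite /refine !xpair_eqE.
apply/idP/idP.
  by move=> /andP[/eqP-> /andP[/eqP-> /eqP->]].
by move: (x \in X) (y \in X) (x \in Y) (y \in Y) => [] [] [] []; lia.
Qed.

End weak_regularity.

Section fiber_avg_extreme.
Variables (R : realFieldType) (I : finType) (T : eqType) (C : I -> T) (F : I -> R).
Hypothesis F01 : forall z, 0 <= F z <= 1.

Lemma fiber_avg_eq0 z : fiber_avg C F z = 0 -> F z = 0.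
Proof.
move=> /eqP; rewrite /fiber_avg mulf_eq0 invr_eq0 (negbTE (fiber_card_neq0 _ _ _)) orbF.
move=> /eqP/psumr_eq0P; apply => // w _; have /andP[] := F01 w; by [].
Qed.

Lemma fiber_avg_eq1 z : fiber_avg C F z = 1 -> F z = 1.
Proof.
rewrite /fiber_avg => /(canRL (divfK (fiber_card_neq0 _ _ _))); rewrite mul1r.
move=> /eqP; rewrite -sumr_const eq_sym -subr_eq0 -sumrB => /eqP/psumr_eq0P H.
apply/eqP; rewrite eq_sym -subr_eq0; apply/eqP/H => [w _|]; last by rewrite inE.
by rewrite subr_ge0; have /andP[] := F01 w.
Qed.

End fiber_avg_extreme.

(** * Random graphs with independent edges *)

Section sum_over_graphs.
Variables (R : realType) (n : nat).
Implicit Types (G : sgraph n).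

Lemma adj_irr G x : adj G (x, x) = false.
Proof. by case: G => a /= /andP[/forallP/(_ x)/negbTE]. Qed.

Lemma adj_sym G x y : adj G (x, y) = adj G (y, x).
Proof. by case: G => a /= /andP[_ /forallP/(_ x)/forallP/(_ y)/eqP]. Qed.

Definition symmetrize (f : {ffun 'I_n * 'I_n -> bool}) : {ffun 'I_n * 'I_n -> bool} :=
  [ffun p : 'I_n * 'I_n => if (p.1 < p.2)%N then f p else (p.2 < p.1)%N && f (p.2, p.1)].

Lemma symmetrize_simple f : simple_adj (symmetrize f).
Proof.
apply/andP; split; first by apply/forallP => x; rewrite ffunE/= ltnn.
apply/forallP => x; apply/forallP => y; rewrite !ffunE/=.
by case: ltngtP.
Qed.

(** A simple graph is an arbitrary choice of a boolean for each pair p.1 < p.2, so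
    this is the expansion of a product of sums. *)
Lemma sum_sgraph_prod (F : 'I_n * 'I_n -> bool -> R) :
  \sum_(G : sgraph n) \prod_(p : 'I_n * 'I_n | (p.1 < p.2)%N) F p (adj G p) =
  \prod_(p : 'I_n * 'I_n | (p.1 < p.2)%N) (F p true + F p false).
Proof.
under [RHS]eq_bigr do rewrite -(big_bool +%R (F _)).
rewrite (big_distr_big_dep false)/=.
pose upper G : {ffun 'I_n * 'I_n -> bool} := [ffun p : 'I_n * 'I_n => (p.1 < p.2)%N && adj G p].
rewrite (reindex_onto upper (fun f => SGraph (symmetrize_simple f))) /=; last first.
  move=> f /pfamilyP[/supportP fsupp _]; apply/ffunP => p; rewrite !ffunE/=.
  by case: ifP => //= /negbT pn; rewrite fsupp.
apply: eq_big => [G|G _].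
  apply/esym/andP; split.
    apply/pfamilyP; split=> //; apply/supportP => p pn.
    by rewrite ffunE; apply/negbTE; rewrite negb_and pn.
  apply/eqP/val_inj; apply/ffunP => -[x y]; rewrite !ffunE/=.
  case: ltngtP => [//|xy|xy]; first by rewrite adj_sym.
  by rewrite (val_inj xy) adj_irr.
by apply: eq_bigr => p p12; rewrite ffunE p12.
Qed.

Lemma swap_pair_inj : injective (fun p : 'I_n * 'I_n => (p.2, p.1)).
Proof. by move=> [x y] [x' y'] [-> ->]. Qed.

Lemma sum_sym_upper (L : 'I_n -> 'I_n -> R) : (forall x y, L x y = L y x) ->
  \sum_x \sum_y L x y =
  2 * \sum_(p : 'I_n * 'I_n | (p.1 < p.2)%N) L p.1 p.2 + \sum_x L x x.
Proof.
move=> Lsym; rewrite pair_big/= (bigID (fun p : 'I_n * 'I_n => (p.1 < p.2)%N))/=.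
rewrite [X in _ + X](bigID (fun p : 'I_n * 'I_n => (p.2 < p.1)%N))/=.
rewrite addrA; congr (_ + _).
  rewrite mulr_natl mulr2n; congr (_ + _).
  rewrite (reindex_inj swap_pair_inj)/=.
  apply: eq_big => [p|p _]; last exact: Lsym.
  by rewrite -leqNgt; case: ltngtP.
rewrite (reindex_onto (fun x : 'I_n => (x, x)) fst)/=.
  by apply: eq_bigl => x; rewrite ltnn eqxx.
move=> [x y]/=; rewrite -!leqNgt -eqn_leq => /eqP/val_inj ->; by [].
Qed.

Definition adjm G : 'I_n -> 'I_n -> R := fun x y => (adj G (x, y))%:R.

Lemma adjm01 G x y : 0 <= adjm G x y <= 1.
Proof. by rewrite /adjm; case: (adj _ _); rewrite ?lexx ?ler01. Qed.

Lemma block_avg_sym (T : eqType) (c : 'I_n -> T) (A : 'I_n -> 'I_n -> R) :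
  (forall x y, A x y = A y x) -> forall x y, block_avg c A x y = block_avg c A y x.
Proof.
move=> Asym x y; rewrite /block_avg /fiber_avg/=; congr (_ / _%:R).
  rewrite (reindex_inj swap_pair_inj)/=.
  by apply: eq_big => [z|z _]; [rewrite !xpair_eqE andbC|exact: Asym].
rewrite -!sum1_card (reindex_inj swap_pair_inj)/=.
by apply: eq_bigl => z; rewrite !inE !xpair_eqE andbC.
Qed.

(** The probability of G when the edges are independent with probabilities h *)
Definition edge_weight (h : 'I_n -> 'I_n -> R) G : R :=
  \prod_(p : 'I_n * 'I_n | (p.1 < p.2)%N)
    (if adj G p then h p.1 p.2 else 1 - h p.1 p.2).

Lemma sum_edge_weight h : \sum_G edge_weight h G = 1.
Proof.
rewrite /edge_weight (sum_sgraph_prod (fun p b => if b then h p.1 p.2 else 1 - h p.1 p.2)).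
by rewrite big1// => p _; rewrite addrC subrK.
Qed.

Lemma edge_weight_ge0 h G : (forall x y, 0 <= h x y <= 1) -> 0 <= edge_weight h G.
Proof.
move=> h01; apply: prodr_ge0 => p _; have := h01 p.1 p.2.
by case: (adj _ _) => /andP[? ?] //; rewrite subr_ge0.
Qed.

(** The logarithm of the weight is affine in the adjacency matrix, with
    coefficients constant on the blocks, so the matrix can be replaced in it by its
    block averages h, which yields the entropy of h. The sum over all ordered pairs
    counts each edge twice, in accordance with the factor 1/2 in the entropy, and
    moreover the diagonal, whose terms ln (1 - h x x) are nonpositive. *)
Lemma edge_weight_block_avg (T : eqType) (c : 'I_n -> T) G :
  expR (\sum_x \sum_y Iscalar (block_avg c (adjm G) x y)) <=
  edge_weight (block_avg c (adjm G)) G.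
Proof.
set h := block_avg c (adjm G).
have h01 x y : 0 <= h x y <= 1 by apply: block_avg01; exact: adjm01.
have hsym x y : h x y = h y x.
  by apply: block_avg_sym => {}x {}y; rewrite /adjm adj_sym.
pose L x y := adjm G x y * (ln (h x y) - ln (1 - h x y)) + ln (1 - h x y).
(* a pair of adjacent vertices has h > 0 and a nonadjacent one has h < 1, so the
   value of ln at 0 does not matter *)
have hE : edge_weight h G = expR (\sum_(p : 'I_n * 'I_n | (p.1 < p.2)%N) L p.1 p.2).
  rewrite expR_sum; apply: eq_bigr => -[x y] _; rewrite /L /adjm/=.
  have /andP[h0 h1] := h01 x y.
  
  case: ifPn => adjxy.
    rewrite mul1r subrK lnK// posrE lt_neqAle h0 andbT eq_sym.
    apply: contraTneq adjxy => /(@fiber_avg_eq0 _ _ _ _ _ (fun z => adjm01 G z.1 z.2)).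
    by rewrite /adjm/=; case: (adj _ _) => // /eqP; rewrite oner_eq0.
  rewrite mul0r add0r lnK// posrE subr_gt0 lt_neqAle h1 andbT.
  apply: contraNneq adjxy => /(@fiber_avg_eq1 _ _ _ _ _ (fun z => adjm01 G z.1 z.2)).
  by rewrite /adjm/=; case: (adj _ _) => // /eqP; rewrite eq_sym oner_eq0.
rewrite hE ler_expR -(ler_pM2l (ltr0n _ 2)).
have Lsym x y : L x y = L y x by rewrite /L /adjm adj_sym hsym.
(* here the matrix is replaced by its block averages *)
have LE : \sum_x \sum_y L x y = 2 * \sum_x \sum_y Iscalar (h x y).
  rewrite mulr_sumr; under [RHS]eq_bigr do rewrite mulr_sumr.
  transitivity (\sum_x \sum_y adjm G x y * (ln (h x y) - ln (1 - h x y)) + \sum_x \sum_y ln (1 - h x y)).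
    by rewrite -big_split; apply: eq_bigr => x _; rewrite -big_split.
  rewrite -(@sum_block_avg R _ _ c); last first.
    move=> x y x' y' cx cy; rewrite /h /block_avg.
    by rewrite (@eq_fiber_avg R _ _ _ _ (x, y) (x', y'))//= cx cy.
  rewrite -big_split; apply: eq_bigr => x _; rewrite -big_split; apply: eq_bigr => y _ /=.
  by rewrite /Iscalar -/(h x y); field.
rewrite -LE (sum_sym_upper Lsym) gerDl; apply: sumr_le0 => x _.
by rewrite /L /adjm adj_irr mul0r add0r ln_le0// gerBl; have /andP[] := h01 x x.
Qed.

End sum_over_graphs.

(** * The upper bound on the partition function *)

Section upper_bound.
Variables (R : realType) (k : nat) (m : 'I_k.+1 -> nat).
Variables (H : forall i : 'I_k.+1, sgraph (m i)) (beta : 'I_k.+1 -> R).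
Hypothesis H1_edge : #|edges (H ord0)| = 1%N.
Hypothesis H_edge : forall i : 'I_k.+1, (0 < #|edges (H i)|)%N.
Hypothesis beta_ge0 : forall i : 'I_k.+1, i != ord0 -> 0 <= beta i.

Definition fin_T n (w : 'I_n -> 'I_n -> R) : R :=
  \sum_(i < k.+1) beta i * fin_density (H i) w.

Lemma scalar_fun_le u : 0 <= u <= 1 ->
  scalar_fun H beta u <= \sum_(i < k.+1) `|beta i| + 2^-1.
Proof.
move=> u01; rewrite /scalar_fun; apply: lerD; last by rewrite lerNl; exact: Iscalar_ge.
apply: ler_sum => i _; apply: le_trans (ler_norm _) _.
rewrite normrM ler_piMr// ger0_norm ?exprn_ge0 ?exprn_ile1//; by case/andP: u01.
Qed.

(** The single edge, whose coefficient has any sign, has the same density in A and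
    in B by the equality of the sums. *)
Lemma fin_T_counting n (A B : 'I_n -> 'I_n -> R) eps : (0 < n)%N ->
  (forall x y, 0 <= A x y <= 1) -> (forall x y, 0 <= B x y <= 1) ->
  \sum_x \sum_y A x y = \sum_x \sum_y B x y ->
  cut_le (fun x y => A x y - B x y) eps ->
  fin_T A <= fin_T B + (\sum_(i < k.+1 | i != ord0) beta i * #|edges (H i)|%:R) * eps.
Proof.
move=> n0 A01 B01 AB cutAB.
rewrite /fin_T (bigD1 ord0)//= [X in _ <= X + _](bigD1 ord0)//= -addrA !fin_density_edge// AB lerD2l.
rewrite mulr_suml -big_split/=; apply: ler_sum => i i0.
rewrite -mulrA -mulrDr; apply: ler_wpM2l; first exact: beta_ge0.
exact: counting_lemma.
Qed.

(** AM-GM turns T(w) into an average over the pairs of vertices, and the scalar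
    bound applies to each pair. *)
Lemma fin_T_le n (w : 'I_n -> 'I_n -> R) s : (0 < n)%N ->
  (forall x y, 0 <= w x y <= 1) ->
  (forall u, 0 <= u <= 1 -> scalar_fun H beta u <= s) ->
  n%:R ^+ 2 * fin_T w <= n%:R ^+ 2 * s + \sum_x \sum_y Iscalar (w x y).
Proof.
move=> n0 w01 ss.
have n2 : 0 < n%:R ^+ 2 :> R by rewrite exprn_gt0// ltr0n.
have TE : fin_T w <= (n%:R ^+ 2)^-1 * \sum_x \sum_y \sum_(i < k.+1) beta i * w x y ^+ #|edges (H i)|.
  under eq_bigr do rewrite exchange_big/=.
  rewrite exchange_big/= mulr_sumr; apply: ler_sum => i _.
  under eq_bigr do rewrite -mulr_sumr.
  rewrite -mulr_sumr [leRHS]mulrCA; have [->|i0] := eqVneq i ord0.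
    by rewrite fin_density_edge// H1_edge.
  rewrite ler_wpM2l ?beta_ge0//; apply: fin_density_le => // x y.
  by have /andP[] := w01 x y.
have -> : n%:R ^+ 2 * s = \sum_(x < n) \sum_(y < n) s.
  by rewrite !sumr_const !card_ord -mulrnA -natrX mulr_natl mulnn.
move: TE; rewrite ler_pdivlMl// => /le_trans; apply.
rewrite -big_split; apply: ler_sum => x _.
rewrite -big_split; apply: ler_sum => y _ /=.
by rewrite -lerBlDr; exact: ss.
Qed.

(** Graphs are sorted by a regular partition together with the numbers of adjacent
    pairs in its blocks, which determine the block averages h. In each group the
    weights exp(n^2 I(h)) add up to at most 1, and T is at most T(h) + E eps. *)
Lemma partition_function_le n r eps s : (0 < n)%N -> 0 < eps -> 1 < r%:R * eps ^+ 2 ->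
  (forall u, 0 <= u <= 1 -> scalar_fun H beta u <= s) ->
  \sum_(G : sgraph n) expR (n%:R ^+ 2 * fin_T (adjm R G)) <=
  ((4 ^ r) ^ n * (n ^ 2).+1 ^ (4 ^ r * 4 ^ r))%N%:R *
    expR (n%:R ^+ 2 * (s + (\sum_(i < k.+1 | i != ord0) beta i * #|edges (H i)|%:R) * eps)).
Proof.
move=> n0 eps0 reps ss; set E := \sum_(i < _ | _) _.
have creg (G : sgraph n) := cid (weak_regularity eps0 reps n0 (@adjm01 R n G)).
pose c G := sval (creg G).
pose cnt G a : nat := (\sum_(z | (c G z.1, c G z.2) == a) adj G z)%N.
pose code (G : sgraph n) : {ffun 'I_n -> 'I_(4 ^ r)} * {ffun 'I_(4 ^ r) * 'I_(4 ^ r) -> 'I_(n ^ 2).+1} :=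
  (c G, [ffun a => inord (cnt G a)]).
have cnt_le G a : (cnt G a <= n ^ 2)%N.
  rewrite -[X in (_ <= X ^ _)%N]card_ord -mulnn -card_prod -sum1_card.
  rewrite /cnt big_mkcond; apply: leq_sum => z _.
  by case: ifP => // _; case: (adj G z).
have cntE (G : sgraph n) x y : block_avg (c G) (adjm R G) x y =
    ((code G).2 (c G x, c G y))%:R / #|[pred w : 'I_n * 'I_n | (c G w.1, c G w.2) == (c G x, c G y)]|%:R.
  rewrite /block_avg /fiber_avg /code/= ffunE inordK ?ltnS ?cnt_le// natr_sum.
  by congr (_ / _); apply: eq_bigr => -[].
have codeE G G' : code G = code G' ->
    block_avg (c G) (adjm R G) = block_avg (c G') (adjm R G').
  move=> GG'; apply/funext => x; apply/funext => y; rewrite !cntE GG'.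
  by have -> : c G = c G' by move: GG' => [].
rewrite (partition_big code xpredT)//=.
have -> : ((4 ^ r) ^ n * (n ^ 2).+1 ^ (4 ^ r * 4 ^ r))%N =
    #|{: {ffun 'I_n -> 'I_(4 ^ r)} * {ffun 'I_(4 ^ r) * 'I_(4 ^ r) -> 'I_(n ^ 2).+1}}|.
  by rewrite card_prod !card_ffun card_prod !card_ord.
rewrite mulr_natl -sumr_const; apply: ler_sum => a _.
have [[G0 G0a]|noG] := pselect (exists G, code G = a); last first.
  rewrite big_pred0 ?expR_ge0// => G; apply/negbTE/eqP => Ga.
  by apply: noG; exists G.
pose h := block_avg (c G0) (adjm R G0).
have h01 x y : 0 <= h x y <= 1 by apply: block_avg01 => {}x {}y; exact: adjm01.
apply: (@le_trans _ _ (\sum_(G | code G == a)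
    expR (n%:R ^+ 2 * (s + E * eps)) * edge_weight h G)); last first.
  rewrite -mulr_sumr ler_piMr ?expR_ge0// -(sum_edge_weight h).
  rewrite [leRHS](bigID (fun G => code G == a))/= lerDl sumr_ge0// => G _.
  exact: edge_weight_ge0.
apply: ler_sum => G /eqP Ga.
have Gh : block_avg (c G) (adjm R G) = h by apply: codeE; rewrite Ga.
apply: (@le_trans _ _ (expR (n%:R ^+ 2 * (s + E * eps)) * expR (\sum_x \sum_y Iscalar (h x y)))); last first.
  by rewrite ler_wpM2l ?expR_ge0// -Gh edge_weight_block_avg.
rewrite -expRD ler_expR.
have n2 : 0 < n%:R ^+ 2 :> R by rewrite exprn_gt0// ltr0n.
apply: (@le_trans _ _ (n%:R ^+ 2 * (fin_T h + E * eps))).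
  rewrite ler_pM2l//; apply: fin_T_counting => //; first exact: adjm01.
    have mul1 (A : 'I_n -> 'I_n -> R) : \sum_x \sum_y A x y = \sum_x \sum_y A x y * 1.
      by apply: eq_bigr => x _; apply: eq_bigr => y _; rewrite mulr1.
    by rewrite -Gh mul1 [RHS]mul1 sum_block_avg.
  by rewrite -Gh; exact: svalP (creg G).
by rewrite !mulrDr [leRHS]addrAC lerD2r; exact: fin_T_le.
Qed.

End upper_bound.

(** * The lower bound on the partition function *)

Section erdos_renyi.
Variables (R : realType) (n : nat) (u : R).
Hypothesis u01 : 0 <= u <= 1.
Local Notation W := (edge_weight (fun _ _ : 'I_n => u)).

Lemma er_subgraph (S : {set 'I_n * 'I_n}) : (forall p, p \in S -> (p.1 < p.2)%N) ->
  \sum_(G : sgraph n) W G * \prod_(p in S) adjm R G p.1 p.2 = u ^+ #|S|.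
Proof.
move=> Slt.
pose F (p : 'I_n * 'I_n) (b : bool) :=
  (if b then u else 1 - u) * (if p \in S then b%:R else 1).
rewrite (eq_bigr (fun G => \prod_(p : 'I_n * 'I_n | (p.1 < p.2)%N) F p (adj G p))); last first.
  move=> G _; rewrite /F big_split/=; congr (_ * _).
  rewrite -big_mkcondr/=; apply: eq_big => [p|[x y] _//].
  by apply/idP/andP => [pS|[]//]; split=> //; exact: Slt.
rewrite sum_sgraph_prod -prodr_const big_mkcond/= [RHS]big_mkcond/=.
apply: eq_bigr => p _; rewrite /F; case: ifP => [p12|/negP np].
  by case: ifP => _; rewrite ?mulr0 ?mulr1 ?addr0// addrC subrK.
by case: ifP => // /Slt.
Qed.

Lemma er_edge (p : 'I_n * 'I_n) : (p.1 < p.2)%N -> \sum_(G : sgraph n) W G * (adj G p)%:R = u.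
Proof.
move=> p12; rewrite -[RHS]expr1 -(cards1 p) -er_subgraph; last first.
  by move=> q; rewrite inE => /eqP->.
by apply: eq_bigr => G _; rewrite big_set1 /adjm -surjective_pairing.
Qed.

(** An injective map sends the edges to different pairs of vertices, which are
    independently adjacent. *)
Lemma er_injective_copy m (H : sgraph m) (f : {ffun 'I_m -> 'I_n}) : injective f ->
  \sum_(G : sgraph n) W G * \prod_(e in edges H) adjm R G (f e.1) (f e.2) =
  u ^+ #|edges H|.
Proof.
move=> finj.
(* the image of an edge, as an increasing pair *)
pose sgm (e : 'I_m * 'I_m) : 'I_n * 'I_n :=
  if (f e.1 < f e.2)%N then (f e.1, f e.2) else (f e.2, f e.1).
have sgm_inj : {in edges H &, injective sgm}.
  move=> [a b] [a' b'] /edgesP/= ab /edgesP/= ab'; rewrite /sgm/=.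
  by case: ifP => _; case: ifP => _ [] /finj ? /finj ?; subst => //;
    move: ab ab' => /ltn_trans h /h; rewrite ltnn.
have sgm_lt p : p \in sgm @: edges H -> (p.1 < p.2)%N.
  move=> /imsetP[e /edgesP e12 ->]; rewrite /sgm; case: ifP => //= /negbT.
  rewrite -leqNgt leq_eqVlt => /orP[/eqP/val_inj/finj e21|//].
  by rewrite e21 ltnn in e12.
rewrite -(card_in_imset sgm_inj) -(er_subgraph sgm_lt).
apply: eq_bigr => G _; rewrite big_imset//=; congr (_ * _); apply: eq_bigr => e _.
by rewrite /sgm; case: ifP => //= _; rewrite /adjm adj_sym.
Qed.

(** A random map from m points to n points is injective unless some point falls on
    an earlier one, which has probability at most m / n for each point. *)
Lemma ffact_ge m : (0 < n)%N -> 1 - (m ^ 2)%:R / n%:R <= (n ^_ m)%:R / n%:R ^+ m :> R.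
Proof.
move=> n0; have n0' : 0 < n%:R :> R by rewrite ltr0n.
have nk j : 0 < n%:R ^+ j :> R by rewrite exprn_gt0.
elim: m => [|m IH]; first by rewrite mul0r subr0 divr1.
have [mn|nm] := leqP m n; last first.
  apply: le_trans (_ : 0 <= _); last by rewrite divr_ge0// ltW.
  by rewrite subr_le0 ler_pdivlMr// mul1r ler_nat; nia.
rewrite ffactnSr natrM natrB// exprSr.
set a := (n ^_ m)%:R / n%:R ^+ m in IH.
have -> : (n ^_ m)%:R * (n%:R - m%:R) / (n%:R ^+ m * n%:R) = a * (1 - m%:R / n%:R) :> R.
  by rewrite /a; field; rewrite !gt_eqF// (nk m).
have a1 : a <= 1.
  rewrite ler_pdivrMr// mul1r -natrX ler_nat.
  by rewrite -[X in (X ^_ _)%N]card_ord -[X in (_ ^_ X)%N]card_ord -card_inj_ffuns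
    (leq_trans (max_card _))// card_ffun !card_ord.
have t0 : 0 <= m%:R / n%:R :> R by rewrite divr_ge0.
have : (m.+1 ^ 2)%:R / n%:R = (m ^ 2)%:R / n%:R + 2 * (m%:R / n%:R) + n%:R^-1 :> R.
  by rewrite !natrX -addn1 natrD; field; rewrite gt_eqF.
have : 0 <= n%:R^-1 :> R by rewrite invr_ge0.
by move=> h ->; nra.
Qed.

(** Only the noninjective maps contribute to the difference, and each by at most 1. *)
Lemma er_density m (H : sgraph m) : (0 < n)%N ->
  `|\sum_(G : sgraph n) W G * fin_density H (adjm R G) - u ^+ #|edges H| |
  <= (m ^ 2)%:R / n%:R.
Proof.
move=> n0; have nk j : 0 < n%:R ^+ j :> R by rewrite exprn_gt0// ltr0n.
pose v (f : {ffun 'I_m -> 'I_n}) :=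
  \sum_(G : sgraph n) W G * \prod_(e in edges H) adjm R G (f e.1) (f e.2).
have u01E : 0 <= u ^+ #|edges H| <= 1.
  by case/andP: u01 => u0 u1; rewrite exprn_ge0// exprn_ile1.
have p01 G (f : {ffun 'I_m -> 'I_n}) : 0 <= \prod_(e in edges H) adjm R G (f e.1) (f e.2) <= 1.
  by apply: prod01 => e; exact: adjm01.
have W0 G : 0 <= W G by exact: edge_weight_ge0.
have v01 f : 0 <= v f <= 1.
  apply/andP; split.
    by apply: sumr_ge0 => G _; rewrite mulr_ge0//; have /andP[] := p01 G f.
  rewrite -(sum_edge_weight (fun _ _ : 'I_n => u)); apply: ler_sum => G _.
  by rewrite ler_piMr//; have /andP[] := p01 G f.
have -> : \sum_(G : sgraph n) W G * fin_density H (adjm R G) =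
    (n%:R ^+ m)^-1 * \sum_f v f.
  rewrite exchange_big/= mulr_sumr; apply: eq_bigr => G _.
  by rewrite /fin_density /hom_sum mulrCA mulr_sumr.
have -> : u ^+ #|edges H| = (n%:R ^+ m)^-1 * \sum_(f : {ffun 'I_m -> 'I_n}) u ^+ #|edges H|.
  rewrite sumr_const card_ffun !card_ord -[X in _ * X]mulr_natl natrX mulKf//.
  by rewrite gt_eqF.
rewrite -mulrBr -sumrB normrM gtr0_norm ?invr_gt0// mulrC ler_pdivrMr//.
apply: le_trans (ler_norm_sum _ _ _) _.
apply: (@le_trans _ _ (\sum_(f : {ffun 'I_m -> 'I_n}) (~~ injectiveb f)%:R)).
  apply: ler_sum => f _; case: injectiveP => [finj|_].
    by rewrite /v er_injective_copy// subrr normr0.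
  move: (v f) (v01 f) => t t01; rewrite ler_norml/=.
  by move: (u ^+ _) u01E => q q01; lra.
have := ffact_ge m n0; rewrite lerBlDr -lerBlDl => /(le_trans _); rewrite -ler_pdivrMr//; apply.
rewrite ler_pdivrMr// mulrBl mul1r divfK ?gt_eqF// lerBrDr.
rewrite -[X in (X ^_ _)%N]card_ord -[X in (_ ^_ X)%N]card_ord -card_inj_ffuns.
rewrite -sum1_card natr_sum [X in _ + X]big_mkcond/= -big_split/=.
rewrite (eq_bigr (fun=> 1)); last first.
  by move=> f _; rewrite inE; case: injectiveb; rewrite ?add0r ?addr0.
by rewrite sumr_const card_ffun !card_ord natrX.
Qed.

(** Each of the n (n - 1) / 2 independent edges contributes 2 I(u). *)
Lemma er_entropy :
  \sum_(G : sgraph n) W G * ln (W G) = (n%:R ^+ 2 - n%:R) * Iscalar u.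
Proof.
pose L b := ln (if b then u else 1 - u).
have LE : \sum_(G : sgraph n) W G * ln (W G) =
    \sum_(G : sgraph n) W G * \sum_(p : 'I_n * 'I_n | (p.1 < p.2)%N) L (adj G p).
  apply: eq_bigr => G _; have [->|W0] := eqVneq (W G) 0; first by rewrite !mul0r.
  congr (_ * _); rewrite -[RHS]expRK expR_sum; congr ln; apply: eq_bigr => p p12.
  rewrite /L lnK// posrE lt0r; apply/andP; split; last first.
    by case/andP: u01 => u0 u1; case: (adj _ _); rewrite ?subr_ge0.
  by move/prodf_neq0: W0 => /(_ p p12).
rewrite LE; under eq_bigr do rewrite mulr_sumr.
rewrite exchange_big/=.
rewrite (eq_bigr (fun=> 2 * Iscalar u)); last first.
  move=> p p12.
  rewrite (eq_bigr (fun G => W G * (adj G p)%:R * (L true - L false) + W G * L false)); last first.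
    by move=> G _; case: (adj G p); rewrite ?mulr1 ?mulr0 ?mul0r ?add0r// mulrBr subrK.
  by rewrite big_split/= -!mulr_suml er_edge// sum_edge_weight /L /Iscalar; field.
have := @sum_sym_upper R n (fun _ _ => 2 * Iscalar u) (fun _ _ => erefl).
rewrite /=; set c := \sum_(p : 'I_n * 'I_n | (p.1 < p.2)%N) _.
rewrite !sumr_const !card_ord -mulrnA -[_ *+ (n * n)]mulr_natl -[_ *+ n]mulr_natl natrM.
rewrite expr2; lra.
Qed.

End erdos_renyi.

Section partition_function_lower.
Variables (R : realType) (k : nat) (m : 'I_k.+1 -> nat).
Variables (H : forall i : 'I_k.+1, sgraph (m i)) (beta : 'I_k.+1 -> R).

(** Jensen's inequality under W: the tangent line of exp at the mean a of
    f - ln W is summed, term by term, against W. *)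
Lemma gibbs_lower_bound (T : finType) (W f : T -> R) :
  (forall x, 0 <= W x) -> \sum_x W x = 1 ->
  expR (\sum_x W x * f x - \sum_x W x * ln (W x)) <= \sum_x expR (f x).
Proof.
move=> W0 W1; set a := _ - _.
have -> : expR a = \sum_x W x * (expR a * (1 + (f x - ln (W x) - a))).
  rewrite [RHS](eq_bigr (fun x => expR a * (W x + (W x * f x - W x * ln (W x) - W x * a)))); last first.
    by move=> x _; ring.
  by rewrite -mulr_sumr big_split/= !sumrB -mulr_suml W1 mul1r -/a subrr addr0 mulr1.
apply: ler_sum => x _; have [->|Wx] := eqVneq (W x) 0; first by rewrite mul0r expR_ge0.
have Wx0 : 0 < W x by rewrite lt0r Wx W0.
have fE : f x = ln (W x) + (a + (f x - ln (W x) - a)) by ring.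
rewrite [X in _ <= expR X]fE [leRHS]expRD lnK// [X in _ <= _ * X]expRD.
by rewrite ler_pM2l// ler_wpM2l ?expR_ge0// expR_ge1Dx.
Qed.

Lemma partition_function_ge n u : (0 < n)%N -> 0 <= u <= 1 ->
  expR (n%:R ^+ 2 * (scalar_fun H beta u -
    (\sum_(i < k.+1) `|beta i| * (m i ^ 2)%:R + 2^-1) / n%:R)) <=
  \sum_(G : sgraph n) expR (n%:R ^+ 2 * fin_T H beta (adjm R G)).
Proof.
move=> n0 u01; set W := @edge_weight R n (fun _ _ => u).
have W0 G : 0 <= W G by exact: edge_weight_ge0.
apply: (le_trans _ (gibbs_lower_bound (fun G => n%:R ^+ 2 * fin_T H beta (adjm R G)) W0
  (sum_edge_weight _))).
rewrite ler_expR er_entropy//.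
rewrite (eq_bigr (fun G => n%:R ^+ 2 * (W G * fin_T H beta (adjm R G)))); last by move=> G _; ring.
rewrite -mulr_sumr /scalar_fun.
set B := \sum_(i < k.+1) `|beta i| * (m i ^ 2)%:R.
set S := \sum_(i < k.+1) beta i * _; set T := \sum_G _.
have n0' : 0 < n%:R :> R by rewrite ltr0n.
have TS : S - B / n%:R <= T.
  rewrite /T; under eq_bigr do rewrite /fin_T mulr_sumr.
  rewrite exchange_big/= /S /B mulr_suml -sumrB; apply: ler_sum => i _.
  under eq_bigr do rewrite mulrCA.
  rewrite -mulr_sumr.
  have := er_density u01 (H i) n0; rewrite -/W.
  set e := \sum_G _; set q := u ^+ _ => h.
  have : `|beta i * (e - q)| <= `|beta i| * ((m i ^ 2)%:R / n%:R).
    by rewrite normrM ler_wpM2l.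
  rewrite ler_norml => /andP[+ _]; lra.
have I2 := Iscalar_ge u01.
have : 0 <= n%:R ^+ 2 * (T - (S - B / n%:R)) by rewrite mulr_ge0 ?exprn_ge0 ?subr_ge0// ltW.
have -> : n%:R ^+ 2 * (S - Iscalar u - (B + 2^-1) / n%:R) =
  n%:R ^+ 2 * S - n%:R ^+ 2 * Iscalar u - n%:R * B - n%:R * 2^-1.
  by field; rewrite gt_eqF.
have -> : n%:R ^+ 2 * (T - (S - B / n%:R)) = n%:R ^+ 2 * T - n%:R ^+ 2 * S + n%:R * B.
  by field; rewrite gt_eqF.
have : 0 <= n%:R * (Iscalar u + 2^-1) by rewrite mulr_ge0//; lra.
by rewrite mulrDr mulrBl; lra.
Qed.



End partition_function_lower.

(** * Integration over cubes *)

Section product_of_domains.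
Context d1 d2 (T1 : measurableType d1) (T2 : measurableType d2) (R : realType).
Variables (m1 : {sigma_finite_measure set T1 -> \bar R}).
Variables (m2 : {sigma_finite_measure set T2 -> \bar R}).
Variables (D1 : set T1) (D2 : set T2) (f : T1 * T2 -> \bar R).
Hypotheses (mD1 : measurable D1) (mD2 : measurable D2).
Hypotheses (mf : measurable_fun setT f) (f0 : forall z, (0 <= f z)%E).
Local Open Scope ereal_scope.

Let D12 := D1 `*` D2.
Let mD12 : measurable D12. Proof. exact: measurableX. Qed.
Let mf12 : measurable_fun setT (f \_ D12).
Proof. by exact: (measurable_restrictT f mD12).1 (measurable_funTS mf). Qed.
Let f120 z : 0 <= (f \_ D12) z.
Proof. by apply: erestrict_ge0 => ? _; exact: f0. Qed.

Lemma ge0_integral_setX1 :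
  \int[m1 \x m2]_(z in D1 `*` D2) f z = \int[m1]_(x in D1) \int[m2]_(y in D2) f (x, y).
Proof.
rewrite integral_mkcond (fubini_tonelli1 _ mf12 f120) [RHS]integral_mkcond.
apply: eq_integral => x _; rewrite /fubini_F patchE.
case: ifPn => xD1.
  rewrite [RHS]integral_mkcond; apply: eq_integral => y _.
  by rewrite !patchE /D12 in_setX xD1.
by apply: integral0_eq => y _; rewrite patchE /D12 in_setX (negbTE xD1).
Qed.

Lemma ge0_integral_setX2 :
  \int[m1 \x m2]_(z in D1 `*` D2) f z = \int[m2]_(y in D2) \int[m1]_(x in D1) f (x, y).
Proof.
rewrite integral_mkcond (fubini_tonelli2 _ mf12 f120) [RHS]integral_mkcond.
apply: eq_integral => y _; rewrite /fubini_G patchE.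
case: ifPn => yD2.
  rewrite [RHS]integral_mkcond; apply: eq_integral => x _.
  by rewrite !patchE /D12 in_setX yD2 andbT.
by apply: integral0_eq => x _; rewrite patchE /D12 in_setX (negbTE yD2) andbF.
Qed.

Lemma measurable_partial_integral :
  measurable_fun setT (fun x => \int[m2]_(y in D2) f (x, y)).
Proof.
have mT : measurable ([set: T1] `*` D2) by exact: measurableX.
have mfT : measurable_fun setT (f \_ ([set: T1] `*` D2)).
  by exact: (measurable_restrictT f mT).1 (measurable_funTS mf).
have fT0 z : 0 <= (f \_ ([set: T1] `*` D2)) z.
  by apply: erestrict_ge0 => ? _; exact: f0.
have := measurable_fun_fubini_tonelli_F (m2 := m2) _ mfT fT0; apply: eq_measurable_fun => x _.
rewrite /fubini_F [RHS]integral_mkcond; apply: eq_integral => y _.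
by rewrite !patchE in_setX in_setT.
Qed.

End product_of_domains.

Section cube.
Variable R : realType.
Local Notation M := (measurableTypeR R).
Local Notation I01 := (`[0%R, 1%R]%classic : set M).
Local Notation leb := (@lebesgue_measure R).
Local Open Scope ereal_scope.

Lemma measurable_unit_interval : measurable I01.
Proof. exact: measurable_itv. Qed.

Lemma lebesgue_unit_interval : leb I01 = 1.
Proof. by rewrite lebesgue_measure_itv/= lte_fin ltr01 -EFinB subr0. Qed.

Lemma measurable_unit_cube n : measurable (@unit_cube R n : set (n.-tuple M)).
Proof.
rewrite (_ : @unit_cube R n = \bigcap_(i in [set: 'I_n]) (fun x : n.-tuple M => tnth x i) @^-1` I01).
  apply: fin_bigcap_measurable => // i _; rewrite -[X in measurable X]setTI.
  by apply: measurable_tnth => //; exact: measurable_unit_interval.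
by apply/seteqP; split=> x /= h i; [move=> _|]; exact: h.
Qed.

Lemma cons_tup_cube n (x : M) (y : n.-tuple M) :
  @unit_cube R n.+1 (cons_tup (x, y)) <-> I01 x /\ @unit_cube R n y.
Proof.
split=> [h|[h1 h2] i].
  split; first exact: (h ord0).
  by move=> i; have := h (lift ord0 i); rewrite /= tnthS.
by case: (unliftP ord0 i) => [j ->|->]; rewrite /= ?tnthS.
Qed.

Lemma cube_integral0 (F : 0.-tuple M -> \bar R) : measurable_fun setT F ->
  \int[lebesgue_tuple R 0]_(x in @unit_cube R 0) F x = F [tuple].
Proof.
move=> mF; rewrite integral_dirac//; last 2 first.
- exact: measurable_unit_cube.
- exact: measurable_funTS.
by rewrite diracE mem_set ?mul1e// => -[].
Qed.

Lemma cube_integralS n (F : n.+1.-tuple M -> \bar R) :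
  measurable_fun setT F -> (forall x, 0 <= F x) ->
  \int[lebesgue_tuple R n.+1]_(x in @unit_cube R n.+1) F x =
  \int[leb]_(x in I01) \int[lebesgue_tuple R n]_(y in @unit_cube R n) F (cons_tup (x, y)).
Proof.
move=> mF F0 /=.
have F0' : {in @unit_cube R n.+1, forall y, 0 <= F y} by move=> y _; exact: F0.
rewrite /lebesgue_cons (ge0_integral_pushforward (@measurable_cons_tup R n) _
  (@measurable_unit_cube n.+1) (measurable_funTS mF) F0').
rewrite -(@ge0_integral_setX1 _ _ _ _ _ leb (lebesgue_tuple R n) _ _ (F \o @cons_tup R n))//.
- congr (integral _ _ _); apply/seteqP; split=> -[x y] /=; first by move/cons_tup_cube.
  by move=> xy; apply/cons_tup_cube.
- exact: measurable_unit_cube.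
- by apply: measurableT_comp => //; exact: measurable_cons_tup.
- by move=> z; exact: F0.
Qed.

End cube.

Section cube_update.
Variable R : realType.
Local Notation M := (measurableTypeR R).
Local Notation I01 := (`[0%R, 1%R]%classic : set M).
Local Notation leb := (@lebesgue_measure R).
Local Open Scope ereal_scope.

Lemma interval_integral_swap (f : M * M -> \bar R) :
  measurable_fun setT f -> (forall z, 0 <= f z) ->
  \int[leb]_(x in I01) \int[leb]_(y in I01) f (x, y) =
  \int[leb]_(y in I01) \int[leb]_(x in I01) f (x, y).
Proof.
move=> mf f0; have mI := @measurable_unit_interval R.
by rewrite -(ge0_integral_setX1 leb leb mI mI mf f0) (ge0_integral_setX2 leb leb mI mI mf f0).
Qed.

Lemma interval_integral_cst (c : \bar R) : \int[leb]_(x in I01) c = c.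
Proof.
rewrite integral_cst; last exact: measurable_unit_interval.
by rewrite [X in _ * X](lebesgue_unit_interval R) mule1.
Qed.

Definition upd_tup n (x : n.-tuple M) (i : 'I_n) (t : M) : n.-tuple M :=
  [tuple if j == i then t else tnth x j | j < n].

Lemma measurable_upd_tup d (T : measurableType d) n (f : T -> n.-tuple M) (i : 'I_n) (g : T -> M) :
  measurable_fun setT f -> measurable_fun setT g ->
  measurable_fun setT (fun z => upd_tup (f z) i (g z)).
Proof.
move=> mf mg; apply/measurable_fun_tnthP => j.
have [ji|ji] := eqVneq j i.
  by apply: (eq_measurable_fun g) => // z _; rewrite /= tnth_mktuple ji eqxx.
apply: (eq_measurable_fun (fun z => tnth (f z) j)) => [z _|].
  by rewrite /= tnth_mktuple (negbTE ji).
exact: (measurableT_comp (measurable_tnth j) mf).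
Qed.

Lemma upd_tup_head n (x t : M) (y : n.-tuple M) :
  upd_tup (cons_tup (x, y)) ord0 t = cons_tup (t, y).
Proof.
apply: eq_from_tnth => j; rewrite tnth_mktuple.
by case: (unliftP ord0 j) => [i ->|->] //=; rewrite !tnthS.
Qed.

Lemma upd_tup_tail n (x t : M) (y : n.-tuple M) (i : 'I_n) :
  upd_tup (cons_tup (x, y)) (lift ord0 i) t = cons_tup (x, upd_tup y i t).
Proof.
apply: eq_from_tnth => j; rewrite tnth_mktuple.
case: (unliftP ord0 j) => [k ->|->] //=.
by rewrite !tnthS tnth_mktuple (inj_eq lift_inj).
Qed.

(** The coordinates of a uniform point of the cube are independent and uniform, so
    one of them can be redrawn. All the marginals needed below are obtained from
    this statement by redrawing coordinates one after the other. *)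
Lemma cube_integral_upd n (i : 'I_n) (F : n.-tuple M -> \bar R) :
  measurable_fun setT F -> (forall x, 0 <= F x) ->
  \int[lebesgue_tuple R n]_(x in @unit_cube R n) F x =
  \int[leb]_(t in I01) \int[lebesgue_tuple R n]_(x in @unit_cube R n) F (upd_tup x i t).
Proof.
elim: n i F => [[]//|n IH] i F mF F0.
have mI := @measurable_unit_interval R.
have mC := @measurable_unit_cube R n.
have mcons d (T : measurableType d) (f : T -> M) (g : T -> n.-tuple M) :
    measurable_fun setT f -> measurable_fun setT g ->
    measurable_fun setT (fun z => F (cons_tup (f z, g z))).
  move=> mf mg; apply: measurableT_comp => //.
  by apply: measurableT_comp; [exact: measurable_cons_tup|exact: measurable_fun_pair].
have mFupd t : measurable_fun setT (fun x => F (upd_tup x i t)).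
  by apply: measurableT_comp => //; apply: measurable_upd_tup.
rewrite cube_integralS//.
under [RHS]eq_integral do rewrite cube_integralS//.
case: (unliftP ord0 i) => [j|] ->.
  under [RHS]eq_integral do under eq_integral do under eq_integral do rewrite upd_tup_tail.
  rewrite -(@interval_integral_swap (fun z => \int[lebesgue_tuple R n]_(y in @unit_cube R n)
    F (cons_tup (z.1, upd_tup y j z.2)))); last 2 first.
  - apply: (measurable_partial_integral (lebesgue_tuple R n) mC
      (f := fun w : (M * M) * n.-tuple M => F (cons_tup (w.1.1, upd_tup w.2 j w.1.2)))) => //.
    apply: mcons; first exact: measurableT_comp.
    by apply: measurable_upd_tup => //; exact: measurableT_comp.
  - by move=> z; exact: integral_ge0.
  apply: eq_integral => x _; apply: (IH j (fun y => F (cons_tup (x, y)))) => //.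
  exact: mcons.
under [RHS]eq_integral do under eq_integral do under eq_integral do rewrite upd_tup_head.
by apply: eq_integral => t _; rewrite interval_integral_cst.
Qed.

Lemma cube_integral_cst n (c : \bar R) : 0 <= c ->
  \int[lebesgue_tuple R n]_(x in @unit_cube R n) c = c.
Proof.
move=> c0; elim: n => [|n IH].
  by rewrite (@cube_integral0 R (fun=> c))//; exact: measurable_cst.
rewrite (@cube_integralS R n (fun=> c))//.
by under eq_integral do rewrite IH; exact: interval_integral_cst.
Qed.

Lemma lebesgue_unit_cube n : lebesgue_tuple R n (@unit_cube R n) = 1.
Proof.
by rewrite -[LHS]mul1e -integral_cst ?cube_integral_cst//; exact: measurable_unit_cube.
Qed.

Lemma measurable_tnth_pair n (p q : 'I_n) :
  measurable_fun setT (fun x : n.-tuple M => (tnth x p, tnth x q)).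
Proof. by apply: measurable_fun_pair; exact: measurable_tnth. Qed.

Lemma cube_integral_pair n (p q : 'I_n) (f : M * M -> \bar R) : p != q ->
  measurable_fun setT f -> (forall z, 0 <= f z) ->
  \int[lebesgue_tuple R n]_(x in @unit_cube R n) f (tnth x p, tnth x q) =
  \int[leb]_(x in I01) \int[leb]_(y in I01) f (x, y).
Proof.
move=> pq mf f0.
have mF : measurable_fun setT (fun x : n.-tuple M => f (tnth x p, tnth x q)).
  by apply: measurableT_comp => //; exact: measurable_tnth_pair.
rewrite (cube_integral_upd p mF)//; apply: eq_integral => t _.
have qp : (q == p) = false by rewrite eq_sym; exact: negbTE.
under eq_integral do rewrite !tnth_mktuple eqxx qp.
have mG : measurable_fun setT (fun x : n.-tuple M => f (t, tnth x q)).
  by apply: measurableT_comp => //; apply: measurable_fun_pair => //; exact: measurable_tnth.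
rewrite (cube_integral_upd q mG)//; apply: eq_integral => s _.
under eq_integral do rewrite !tnth_mktuple eqxx.
by rewrite cube_integral_cst.
Qed.

End cube_update.

(** * Homomorphism densities of graphs as integrals *)

Section step_functions.
Variables (R : realType) (n : nat).
Hypothesis n0 : (0 < n)%N.
Local Notation M := (measurableTypeR R).
Local Notation I01 := (`[0%R, 1%R]%classic : set M).
Local Notation leb := (@lebesgue_measure R).

(** The right end point of a cell belongs to the cell, so it can represent it. *)
Definition cell_pt (i : 'I_n) : M := i.+1%:R / n%:R.

Lemma ceil_cellE (i : 'I_n) (x : M) :
  (Num.ceil (n%:R * x) == i.+1%:Z) = (x \in `]i%:R / n%:R, i.+1%:R / n%:R]).
Proof.
have n0' : 0 < n%:R :> R by rewrite ltr0n.
rewrite ceil_eq in_itv/= ltr_pdivrMr// ler_pdivlMr// [x * _]mulrC.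
by rewrite -[i.+1]addn1 PoszD addrK -!pmulrn addn1.
Qed.

Lemma ceil_cell (i : 'I_n) (x : M) : x \in `]i%:R / n%:R, i.+1%:R / n%:R] ->
  Num.ceil (n%:R * x) = i.+1%:Z.
Proof. by rewrite -ceil_cellE => /eqP. Qed.

Lemma cell_pt_itv (i : 'I_n) : cell_pt i \in `]i%:R / n%:R, i.+1%:R / n%:R].
Proof.
rewrite in_itv/= lexx andbT ltr_pM2r ?invr_gt0 ?ltr0n//.
by rewrite ltr_nat.
Qed.

(** The point 0, which belongs to no cell, has measure zero. *)
Lemma interval_integral_step (g : M -> \bar R) :
  measurable_fun setT g -> (forall x, 0 <= g x)%E ->
  (forall x y : M, Num.ceil (n%:R * x) = Num.ceil (n%:R * y) -> g x = g y) ->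
  (\int[leb]_(x in I01) g x = (n%:R^-1)%:E * \sum_(i < n) g (cell_pt i))%E.
Proof.
move=> mg g0 gstep.
have n0' : 0 < n%:R :> R by rewrite ltr0n.
pose F (i : 'I_n) : set M := `]i%:R / n%:R, i.+1%:R / n%:R]%classic.
have mF i : measurable (F i) by exact: measurable_itv.
rewrite -(@integral_itv_obnd_cbnd R 0 (BRight 1)); last exact: measurable_funTS.
have FU : `]0%R, 1%R]%classic = \big[setU/set0]_(i <- enum 'I_n) F i.
  rewrite -bigcup_seq; apply/seteqP; split=> x.
    rewrite /= in_itv/= => /andP[x0 x1].
    have c0 : (0 < Num.ceil (n%:R * x))%R by rewrite ceil_gt0 mulr_gt0.
    have c1 : (Num.ceil (n%:R * x) <= n%:Z)%R by rewrite ceil_le_int -pmulrn ler_piMr// ltW.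
    move: c0 c1; case E : (Num.ceil (n%:R * x)) => [[|c]|c]// _ cn.
    have cn' : (c < n)%N by [].
    exists (Ordinal cn'); first by rewrite /= mem_enum.
    rewrite /F/= in_itv/= ltr_pdivrMr// ler_pdivlMr//.
    have := ceil_itv (n%:R * x); rewrite E -addn1 PoszD addrK -!pmulrn mulrC; exact.
  move=> [i _]; rewrite /F/= !in_itv/= => /andP[h1 h2]; apply/andP; split.
    by apply: le_lt_trans h1; rewrite divr_ge0.
  apply: (le_trans h2); rewrite ler_pdivrMr// mul1r ler_nat; exact: ltn_ord.
rewrite FU ge0_integral_bigsetU//; last 3 first.
- exact: enum_uniq.
- apply/trivIsetP => i j _ _ ij; apply/seteqP; split=> // x [/ceil_cell xi /ceil_cell].
  by rewrite xi => -[] /val_inj/eqP; rewrite (negbTE ij).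
- exact: measurable_funTS.
rewrite big_enum/= ge0_sume_distrr//; apply: eq_bigr => i _.
rewrite (eq_integral (fun=> g (cell_pt i))); last first.
  move=> x; rewrite inE => xi; apply: gstep.
  by rewrite (ceil_cell xi) (ceil_cell (cell_pt_itv i)).
rewrite integral_cst// muleC; congr (_ * _)%E.
rewrite [LHS](lebesgue_measure_itv `]i%:R / n%:R, i.+1%:R / n%:R])/= lte_fin ltr_pM2r ?invr_gt0// ltr_nat ltnSn.
by rewrite -EFinB -mulrBl -natrB// subSnn div1r.
Qed.

Lemma cube_integral_step m (F : m.-tuple M -> \bar R) :
  measurable_fun setT F -> (forall x, 0 <= F x)%E ->
  (forall x y : m.-tuple M, (forall i, Num.ceil (n%:R * tnth x i) = Num.ceil (n%:R * tnth y i)) ->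
    F x = F y) ->
  (\int[lebesgue_tuple R m]_(x in @unit_cube R m) F x =
   ((n%:R ^+ m)^-1)%:E * \sum_(t : m.-tuple 'I_n) F (map_tuple cell_pt t))%E.
Proof.
elim: m F => [|m IH] F mF F0 Fstep.
  rewrite cube_integral0// expr0 invr1 mul1e (big_pred1 [tuple])//; last first.
    by move=> t; apply/esym/eqP; exact: tuple0.
  by congr F; apply/val_inj.
rewrite cube_integralS//.
have mcons d (T : measurableType d) (f : T -> M) (g : T -> m.-tuple M) :
    measurable_fun setT f -> measurable_fun setT g ->
    measurable_fun setT (fun z => F (cons_tup (f z, g z))).
  move=> mf mg; apply: measurableT_comp => //.
  by apply: measurableT_comp; [exact: measurable_cons_tup|exact: measurable_fun_pair].
under eq_integral => x _.
  rewrite (IH (fun y => F (cons_tup (x, y)))); [|exact: mcons| |]; last 2 first.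
  - by move=> y; exact: F0.
  - move=> y z yz; apply: Fstep => i.
    by case: (unliftP ord0 i) => [j ->|->] //=; rewrite !tnthS.
  over.
rewrite /= ge0_integralZl//; last 2 first.
- apply: emeasurable_sum => t; apply: measurable_funTS; exact: mcons.
- by move=> x _; exact: sume_ge0.
rewrite ge0_integral_sum//; last first.
  by move=> t; apply: measurable_funTS; exact: mcons.
rewrite [X in (_ * X = _)%E](eq_bigr (fun t : m.-tuple 'I_n =>
    (n%:R^-1)%:E * \sum_(i < n) F (cons_tup (cell_pt i, map_tuple cell_pt t)))%E); last first.
  move=> t _; rewrite (@interval_integral_step (fun x => F (cons_tup (x, map_tuple cell_pt t))))//.
    exact: mcons.
  move=> x y xy; apply: Fstep => i.
  by case: (unliftP ord0 i) => [j ->|->] //=; rewrite !tnthS.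
rewrite /= -ge0_sume_distrr; last by move=> t _; exact: sume_ge0.
rewrite muleA -EFinM -invfM -exprSr; congr (_ * _)%E.
rewrite exchange_big pair_big/=.
rewrite (reindex (fun p : 'I_n * m.-tuple 'I_n => [tuple of p.1 :: p.2]))/=; last first.
  exists (fun t : m.+1.-tuple 'I_n => (thead t, [tuple of behead t])) => [[i t] _|t _].
    by congr (_, _); apply/val_inj.
  by rewrite -tuple_eta.
by apply: eq_bigr => -[i t] _; congr F; apply/val_inj.
Qed.

End step_functions.

Section measurable_densities.
Variable R : realType.
Local Notation M := (measurableTypeR R).

Lemma measurable_hom_prod m (H : sgraph m) (h : M * M -> R) : measurable_fun setT h ->
  measurable_fun setT
    (fun x : m.-tuple M => \prod_(e in edges H) h (tnth x e.1, tnth x e.2)).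
Proof.
move=> mh; under eq_fun do rewrite -big_enum; apply: measurable_prod => e _.
by apply: measurableT_comp => //; exact: measurable_tnth_pair.
Qed.

Variables (n : nat) (n0 : (0 < n)%N) (G : sgraph n).
Local Notation cell i := `]i%:R / n%:R, i.+1%:R / n%:R].

Lemma graphon_ofE : @graphon_of R _ G =
  \1_(\bigcup_(p in [set p : 'I_n * 'I_n | adj G p])
    ([set` cell p.1] `*` [set` cell p.2])%classic) :> (R * R -> R).
Proof.
apply/funext => -[x y]; rewrite /graphon_of indicE; congr (_%:R); congr (nat_of_bool _).
apply/idP/idP => [/existsP[i /existsP[j /and3P[xi yj ij]]]|].
  apply/mem_set; exists (i, j) => //=.
  by move: xi yj; rewrite !(ceil_cellE n0).
move=> /set_mem[[i j] /= ij [xi yj]]; apply/existsP; exists i; apply/existsP; exists j.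
by rewrite !(ceil_cellE n0) xi yj.
Qed.

Lemma measurable_graphon_of : measurable_fun setT (@graphon_of R _ G : M * M -> R).
Proof.
rewrite graphon_ofE; apply: measurable_indic.
apply: fin_bigcup_measurable => // p _; apply: measurableX; exact: measurable_itv.
Qed.

Lemma graphon_of_cell_pt (i j : 'I_n) :
  @graphon_of R _ G (cell_pt R i, cell_pt R j) = adjm R G i j.
Proof.
rewrite /graphon_of /adjm; congr (_%:R); congr (nat_of_bool _).
apply/idP/idP => [/existsP[i' /existsP[j' /=]]|ij]; last first.
  by apply/existsP; exists i; apply/existsP; exists j; rewrite /= !(ceil_cell n0 (cell_pt_itv R n0 _)) !eqxx.
rewrite !(ceil_cell n0 (cell_pt_itv R n0 _)) !eqz_nat !eqSS.
by move=> /and3P[/eqP/val_inj <- /eqP/val_inj <-].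
Qed.

Lemma hom_density_graphon_of m (H : sgraph m) :
  hom_density H (@graphon_of R _ G) = fin_density H (adjm R G).
Proof.
rewrite /hom_density /Rintegral.
rewrite (@cube_integral_step R n n0 m (fun x =>
  (\prod_(e in edges H) @graphon_of R _ G (tnth x e.1, tnth x e.2))%:E)); last 3 first.
- apply/measurable_EFinP; apply: measurable_hom_prod; exact: measurable_graphon_of.
- by move=> x; rewrite lee_fin; apply: prodr_ge0 => e _; rewrite ler0n.
- move=> x y xy; congr (_%:E); apply: eq_bigr => e _.
  by rewrite /graphon_of/= !xy.
rewrite sumEFin /= /fin_density /hom_sum; congr (_ * _).
rewrite (reindex (fun f : {ffun 'I_m -> 'I_n} => [tuple f i | i < m]))/=; last first.
  exists (fun t : m.-tuple 'I_n => [ffun i => tnth t i]) => [f _|t _].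
    by apply/ffunP => i; rewrite ffunE tnth_mktuple.
  by apply: eq_from_tnth => i; rewrite tnth_mktuple ffunE.
apply: eq_bigr => f _; apply: eq_bigr => e _.
by rewrite !tnth_map -!/(cell_pt R _) graphon_of_cell_pt !tnth_ord_tuple.
Qed.

End measurable_densities.

(** * The limit of psi *)

Section limit.
Variables (R : realType) (k : nat) (m : 'I_k.+1 -> nat).
Variables (H : forall i : 'I_k.+1, sgraph (m i)) (beta : 'I_k.+1 -> R).
Hypothesis H1_edge : #|edges (H ord0)| = 1%N.
Hypothesis H_edge : forall i : 'I_k.+1, (0 < #|edges (H i)|)%N.
Hypothesis beta_ge0 : forall i : 'I_k.+1, i != ord0 -> 0 <= beta i.
Local Notation S := [set scalar_fun H beta u | u in `[0, 1]%classic].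

Lemma has_sup_scalar_fun : has_sup S.
Proof.
split; first by exists (scalar_fun H beta 0); exists 0 => //=; rewrite in_itv/= lexx ler01.
exists (\sum_(i < k.+1) `|beta i| + 2^-1) => _ [u /= u01 <-].
by apply: scalar_fun_le; move: u01; rewrite in_itv.
Qed.

Lemma scalar_fun_le_sup u : 0 <= u <= 1 -> scalar_fun H beta u <= sup S.
Proof.
move=> u01; apply: ub_le_sup; first exact: has_sup_scalar_fun.2.
by exists u => //=; rewrite in_itv.
Qed.

Lemma Tfun_graphon_of n (G : sgraph n) : (0 < n)%N ->
  Tfun H beta (@graphon_of R n G) = fin_T H beta (adjm R G).
Proof. by move=> n0; apply: eq_bigr => i _; rewrite hom_density_graphon_of. Qed.

Lemma psi_ge u n : (0 < n)%N -> 0 <= u <= 1 ->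
  scalar_fun H beta u - (\sum_(i < k.+1) `|beta i| * (m i ^ 2)%:R + 2^-1) / n%:R
    <= psi H beta n.
Proof.
move=> n0 u01; have n2 : 0 < n%:R ^+ 2 :> R by rewrite exprn_gt0// ltr0n.
rewrite /psi ler_pdivlMl//.
have Z := partition_function_ge H beta n0 u01.
rewrite (eq_bigr _ (fun G _ => congr1 (fun t => expR (_ * t)) (Tfun_graphon_of G n0))).
rewrite -[leLHS]expRK ler_ln ?posrE ?expR_gt0//.
exact: lt_le_trans (expR_gt0 _) Z.
Qed.

(** The constant B bounds the contribution of the number of partitions and block
    counts, whose logarithm is O(n). *)
Lemma psi_le eps : 0 < eps -> exists B : R, forall n, (0 < n)%N ->
  psi H beta n <= sup S + eps + B / n%:R.
Proof.
move=> eps0; set E := \sum_(i < k.+1 | i != ord0) beta i * #|edges (H i)|%:R.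
have E0 : 0 <= E by apply: sumr_ge0 => i i0; rewrite mulr_ge0// beta_ge0.
pose d := eps / (E + 1).
have d0 : 0 < d by rewrite divr_gt0// ltr_wpDl.
have Ed : E * d <= eps.
  by rewrite /d mulrCA ler_piMr ?(ltW eps0)// ler_pdivrMr ?mul1r ?lerDl// ltr_wpDl.
have [r rd] : exists r, 1 < r%:R * d ^+ 2.
  exists (Num.truncn (d ^- 2)).+1; rewrite -ltr_pdivrMr ?exprn_gt0// mul1r.
  exact: truncnS_gt.
have [K KE] : exists K, K = (4 ^ r)%N by exists (4 ^ r)%N.
exists (ln (K%:R : R) + (K * K)%:R * 2) => n n0.
have n0' : 0 < n%:R :> R by rewrite ltr0n.
have n2 : 0 < n%:R ^+ 2 :> R by rewrite exprn_gt0.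
have K0 : (0 < K)%N by rewrite KE expn_gt0.
have Z := partition_function_le H1_edge H_edge beta_ge0 n0 d0 rd scalar_fun_le_sup.
rewrite /psi ler_pdivrMl//.
rewrite (eq_bigr _ (fun G _ => congr1 (fun t => expR (_ * t)) (Tfun_graphon_of G n0))).
have Z0 : 0 < \sum_(G : sgraph n) expR (n%:R ^+ 2 * fin_T H beta (adjm R G)).
  have u01 : 0 <= (0 : R) <= 1 by rewrite lexx ler01.
  exact: lt_le_trans (expR_gt0 _) (partition_function_ge H beta n0 u01).
move: Z; rewrite -KE -/E -ler_ln ?posrE//; last first.
  by rewrite mulr_gt0 ?expR_gt0// ltr0n muln_gt0 !expn_gt0 ?K0.
rewrite lnM ?posrE ?expR_gt0 ?ltr0n ?muln_gt0 ?expn_gt0 ?K0// expRK.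
rewrite natrM lnM ?posrE ?ltr0n ?expn_gt0 ?K0// !natrX !lnXn ?ltr0n//.
move=> /le_trans; apply.
have ln_n : ln ((n ^ 2).+1%:R : R) <= 2 * n%:R.
  have : ln ((n ^ 2).+1%:R : R) <= ln ((n.+1)%:R ^+ 2).
    by rewrite ler_ln ?posrE ?exprn_gt0 ?ltr0n// -natrX ler_nat; lia.
  rewrite lnXn ?ltr0n// => /le_trans; apply; rewrite -[leLHS]mulr_natl ler_pM2l//.
  by rewrite -addn1 natrD addrC; apply: le_ln1Dx; apply: lt_trans n0'; rewrite ltrN10.
have e1 : n%:R ^+ 2 * (sup S + eps + (ln K%:R + (K * K)%:R * 2) / n%:R) =
  n%:R * ln K%:R + (K * K)%:R * (2 * n%:R) + n%:R ^+ 2 * (sup S + eps).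
  by field; rewrite gt_eqF.
rewrite e1 -[_ *+ n]mulr_natl -[_ *+ (K * K)]mulr_natl; apply: lerD; last by rewrite ler_pM2l// lerD2l.
by rewrite lerD2l; apply: ler_wpM2l.
Qed.

Lemma psi_cvg : psi H beta n @[n --> \oo] --> sup S.
Proof.
apply/cvgrPdist_le => e e0.
have e2 : 0 < e / 2 by rewrite divr_gt0.
have [B psiB] := psi_le e2.
have [_ [u /= u01 <-] us] := sup_adherent e2 has_sup_scalar_fun.
rewrite in_itv/= in u01.
set D := \sum_(i < k.+1) `|beta i| * (m i ^ 2)%:R + 2^-1.
near=> n.
have n0 : (0 < n)%N by near: n; exact: nbhs_infty_gt.
have n0' : 0 < n%:R :> R by rewrite ltr0n.
have Bn : B / n%:R <= e / 2.
  by rewrite ler_pdivrMr// -ler_pdivrMl//; near: n; exact: nbhs_infty_ger.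
have Dn : D / n%:R <= e / 2.
  by rewrite ler_pdivrMr// -ler_pdivrMl//; near: n; exact: nbhs_infty_ger.
have h1 := psiB n n0; have := psi_ge n0 u01; rewrite -/D => h2.
by rewrite ler_distlC; apply/andP; split; lra.
Unshelve. all: by end_near. Qed.

End limit.

(** * Vanishing integrals *)

Lemma ae_weaken d (T : measurableType d) (R : realType) (mu : set T -> \bar R) (P Q : T -> Prop) :
  (forall x, P x -> Q x) -> {ae mu, forall x, P x} -> {ae mu, forall x, Q x}.
Proof.
move=> PQ [A [mA A0 PA]]; exists A; split => // x nQ; apply: PA => /= Px.
exact/nQ/PQ.
Qed.

Section probability_integrals.
Context d (T : measurableType d) (R : realType) (mu : {measure set T -> \bar R}).
Variable D : set T.
Hypotheses (mD : measurable D) (muD : mu D = 1%E).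

Lemma bounded_integrable (f : T -> R) (B : R) : measurable_fun D f ->
  (forall x, D x -> `|f x| <= B) -> mu.-integrable D (EFin \o f).
Proof.
move=> mf fB; apply: measurable_bounded_integrable => //; first by rewrite muD ltry.
exists B; split; first exact: num_real.
by move=> b Bb x Dx; apply: le_trans (fB x Dx) (ltW Bb).
Qed.

Lemma Rintegral_sum (I : Type) (s : seq I) (P : pred I) (f : I -> T -> R) :
  (forall i, mu.-integrable D (EFin \o f i)) ->
  \int[mu]_(x in D) (\sum_(i <- s | P i) f i x) = \sum_(i <- s | P i) \int[mu]_(x in D) f i x.
Proof.
move=> intf; elim: s => [|i s IH].
  under eq_Rintegral do rewrite big_nil.
  by rewrite big_nil Rintegral_cst// mul0r.
rewrite big_cons -IH; under eq_Rintegral do rewrite big_cons.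
case: (P i) => //; rewrite RintegralD//.
have := @integrable_sum _ _ _ mu D mD _ s P (fun i => EFin \o f i) (fun i _ => intf i).
by congr (mu.-integrable D _); apply/funext => x /=; rewrite sumEFin.
Qed.

Lemma Rintegral_prob_cst (c : R) : \int[mu]_(x in D) c = c.
Proof. by rewrite Rintegral_cst// muD mulr1. Qed.

Lemma integral0_ae (f : T -> \bar R) : measurable_fun D f ->
  (forall x, D x -> (0 <= f x)%E) -> (\int[mu]_(x in D) f x = 0)%E ->
  {ae mu, forall x, D x -> f x = 0%E}.
Proof.
move=> mf f0 If; apply/(ae_eq_integral_abs mu mD mf).
rewrite -[RHS]If; apply: eq_integral => x; rewrite inE => Dx.
by rewrite gee0_abs// f0.
Qed.

Lemma Rintegral0_ae (f : T -> R) (B : R) : measurable_fun D f ->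
  (forall x, D x -> 0 <= f x <= B) -> \int[mu]_(x in D) f x = 0 ->
  {ae mu, forall x, D x -> f x = 0}.
Proof.
move=> mf fB If.
have intf : mu.-integrable D (EFin \o f).
  by apply: (@bounded_integrable _ B) => // x /fB /andP[f0 fle]; rewrite ger0_norm.
have : {ae mu, forall x, D x -> (EFin \o f) x = 0%E}.
  apply: integral0_ae; first exact/measurable_EFinP.
    by move=> x /fB /andP[f0 _]; rewrite lee_fin.
  by rewrite -[LHS]fineK ?integrable_fin_num//= -[fine _]/(\int[mu]_(x in D) f x) If.
by apply: ae_weaken => x fx Dx; case: (fx Dx).
Qed.

Lemma ae_exists (P : T -> Prop) : {ae mu, forall x, D x -> P x} ->
  exists2 x, D x & P x.
Proof.
move=> aeP; apply: contrapT => noP.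
have : mu D = 0%E.
  apply: measure_negligible => //; apply: negligibleS aeP => x Dx /= PDx.
  by apply: noP; exists x => //; exact: PDx.
by rewrite muD => /eqP; rewrite onee_eq0.
Qed.

Lemma ae_exists2 (P Q : T -> Prop) : {ae mu, forall x, D x -> P x} ->
  {ae mu, forall x, D x -> Q x} -> exists x, [/\ D x, P x & Q x].
Proof.
move=> aeP aeQ; have [|x Dx [Px Qx]] := @ae_exists (fun x => P x /\ Q x).
  apply: negligibleS (negligibleU aeP aeQ) => x /= nPQ.
  by apply: contrapT => /not_orP[/contrapT DP /contrapT DQ]; apply: nPQ => Dx; split; auto.
by exists x.
Qed.

Lemma integral0_exists (f : T -> \bar R) : measurable_fun D f ->
  (forall x, D x -> (0 <= f x)%E) -> (\int[mu]_(x in D) f x = 0)%E ->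
  exists2 x, D x & f x = 0%E.
Proof. by move=> mf f0 If; apply: ae_exists; exact: integral0_ae. Qed.

End probability_integrals.

(** * Symmetric functions depending on one variable only *)

Section rigidity.
Variable R : realType.
Local Notation M := (measurableTypeR R).
Local Notation I01 := (`[0%R, 1%R]%classic : set M).
Local Notation leb := (@lebesgue_measure R).
Local Notation leb2 := (@lebesgue_measure R \x @lebesgue_measure R)%E.

Lemma measurable_unit_square : measurable (@unit_square R : set (M * M)).
Proof. by apply: measurableX; exact: measurable_unit_interval. Qed.

Lemma lebesgue_unit_square : leb2 (@unit_square R) = 1%E.
Proof.
rewrite product_measure1E; [|exact: measurable_unit_interval|exact: measurable_unit_interval].
by rewrite [X in (X * X)%E](lebesgue_unit_interval R) mule1.
Qed.

Local Open Scope ereal_scope.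

Lemma square_integralE (f : M * M -> \bar R) : measurable_fun setT f -> (forall z, 0 <= f z) ->
  \int[leb2]_(z in @unit_square R) f z = \int[leb]_(x in I01) \int[leb]_(y in I01) f (x, y).
Proof.
move=> mf f0; have mI := @measurable_unit_interval R.
by rewrite -(ge0_integral_setX1 leb leb mI mI mf f0).
Qed.

Section symmetric_kernel.
Variable g : M * M -> R.
Hypothesis mg : measurable_fun setT g.
Hypothesis gsym : forall x y, g (x, y) = g (y, x).

(* the L1 distance on the square, as an iterated integral *)
Let dist (f1 f2 : M * M -> R) : \bar R :=
  \int[leb]_(x in I01) \int[leb]_(y in I01) `|f1 (x, y) - f2 (x, y)|%:E.

Let mdist (f1 f2 : M * M -> R) : measurable_fun setT f1 -> measurable_fun setT f2 ->
  measurable_fun setT (fun z => `|f1 z - f2 z|%:E).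
Proof.
move=> mf1 mf2; apply/measurable_EFinP; apply: measurableT_comp => //.
exact: measurable_funB.
Qed.

Let distE (f1 f2 : M * M -> R) : measurable_fun setT f1 -> measurable_fun setT f2 ->
  dist f1 f2 = \int[leb2]_(z in @unit_square R) `|f1 z - f2 z|%:E.
Proof.
by move=> mf1 mf2; rewrite square_integralE//; exact: mdist.
Qed.

Let dist_triangle (f1 f2 f3 : M * M -> R) : measurable_fun setT f1 -> measurable_fun setT f2 ->
  measurable_fun setT f3 -> dist f2 f1 = 0 -> dist f2 f3 = 0 -> dist f1 f3 = 0.
Proof.
move=> m1 m2 m3 d1 d2; have mI := @measurable_unit_interval R.
apply/eqP; rewrite eq_le; apply/andP; split; last first.
  by apply: integral_ge0 => x _; apply: integral_ge0 => y _; rewrite lee_fin.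
rewrite -[leRHS](adde0 0) -{1}d1 -d2 !distE//.
have mS := measurable_unit_square.
have n0 (f1' f2' : M * M -> R) z : @unit_square R z -> 0 <= `|f1' z - f2' z|%:E by rewrite lee_fin.
have m21 := measurable_funTS (mdist m2 m1) : measurable_fun (@unit_square R) _.
have m23 := measurable_funTS (mdist m2 m3) : measurable_fun (@unit_square R) _.
have m13 := measurable_funTS (mdist m1 m3) : measurable_fun (@unit_square R) _.
rewrite -(ge0_integralD leb2 mS (@n0 _ _) m21 (@n0 _ _) m23).
apply: ge0_le_integral; [exact: mS|exact: n0|exact: m13|exact: emeasurable_funD|].
move=> z _; rewrite -EFinD lee_fin.
by rewrite (distrC (f2 z)) ler_distD.
Qed.

Lemma measurable_section_dist : measurable_fun setT
  (fun t => \int[leb]_(y in I01) \int[leb]_(z in I01) `|g (y, z) - g (y, t)|%:E).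
Proof.
have mI := @measurable_unit_interval R.
have mg2 (u v : (M * M) * M -> M) : measurable_fun setT u -> measurable_fun setT v ->
  measurable_fun setT (fun w => g (u w, v w)).
  by move=> mu mv; apply: measurableT_comp => //; exact: measurable_fun_pair.
have := @measurable_partial_integral _ _ M M R leb _
  (fun w : M * M => \int[leb]_(z in I01) `|g (w.2, z) - g (w.2, w.1)|%:E) mI.
apply => [|w]; last by apply: integral_ge0 => z _; rewrite lee_fin.
apply: (@measurable_partial_integral _ _ _ M R leb _
  (fun w : (M * M) * M => `|g (w.1.2, w.2) - g (w.1.2, w.1.1)|%:E) mI).
  apply/measurable_EFinP; apply: measurableT_comp => //.
  by apply: measurable_funB; apply: mg2 => //; exact: measurableT_comp.
by move=> w; rewrite lee_fin.
Qed.

(** For some t the section k = g (_, t) satisfies g (y, z) = k y almost everywhere,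
    hence g (y, z) = k z by symmetry, hence k y = k z. So k is almost everywhere
    equal to its value at some b, and so is g. *)
Lemma symmetric_kernel_constant :
  \int[leb]_(t in I01) \int[leb]_(y in I01) \int[leb]_(z in I01) `|g (y, z) - g (y, t)|%:E = 0 ->
  exists z0, @unit_square R z0 /\
    {ae leb2, forall z, @unit_square R z -> g z = g z0}.
Proof.
move=> K0; have mI := @measurable_unit_interval R.
have [t It] : exists2 t, I01 t & dist g (fun z => g (z.1, t)) = 0.
  apply: (integral0_exists mI (lebesgue_unit_interval R) _ _ K0).
    by apply: measurable_funTS; exact: measurable_section_dist.
  by move=> t _; apply: integral_ge0 => x _; apply: integral_ge0 => y _; rewrite lee_fin.
set k := fun x => g (x, t) => gk1.
have mk : measurable_fun setT k by exact: measurable_fun_pair1.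
have mk1 : measurable_fun setT (fun z : M * M => k z.1) by exact: measurableT_comp.
have mk2 : measurable_fun setT (fun z : M * M => k z.2) by exact: measurableT_comp.
have gk2 : dist g (fun z => k z.2) = 0.
  rewrite /dist (@interval_integral_swap R (fun z => `|g z - k z.2|%:E)).
  - by rewrite -[RHS]gk1; apply: eq_integral => x _; apply: eq_integral => y _; rewrite [g (y, x)]gsym.
  - exact: mdist.
  - by move=> z; rewrite lee_fin.
have kk := dist_triangle mk1 mg mk2 gk1 gk2.
have [b Ib kb] : exists2 b, I01 b & \int[leb]_(y in I01) `|k b - k y|%:E = 0.
  apply: (integral0_exists mI (lebesgue_unit_interval R) _ _ kk).
    apply: measurable_funTS.
    apply: (@measurable_partial_integral _ _ M M R leb _ (fun z => `|k z.1 - k z.2|%:E) mI).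
      exact: mdist.
    by move=> z; rewrite lee_fin.
  by move=> x _; apply: integral_ge0 => y _; rewrite lee_fin.
exists (b, t); split; first by split.
have kg : dist (fun z => k z.2) g = 0.
  rewrite -[RHS]gk2; apply: eq_integral => x _; apply: eq_integral => y _.
  by rewrite distrC.
have kc : dist (fun z => k z.2) (fun=> k b) = 0.
  rewrite /dist -[RHS]interval_integral_cst; apply: eq_integral => x _.
  by rewrite -[RHS]kb; apply: eq_integral => y _; rewrite distrC.
have mc : measurable_fun [set: (M * M)%type] (fun=> k b) by exact: measurable_cst.
have gc := dist_triangle mg mk2 mc kg kc.
have mD : measurable_fun setT (fun z => `|g z - k b|%:E).
  exact: (mdist mg mc).
have : {ae leb2, forall z, @unit_square R z -> `|g z - k b|%:E = 0}.
  apply: (integral0_ae measurable_unit_square).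
  - exact: measurable_funTS.
  - by move=> z _; rewrite lee_fin.
  - by rewrite square_integralE// => z; rewrite lee_fin.
apply: ae_weaken => z gz Dz; have [/eqP] := gz Dz.
by rewrite normr_eq0 subr_eq0 => /eqP.
Qed.

End symmetric_kernel.

End rigidity.

(** * Graphons and the defect of AM-GM *)

Section graphon_densities.
Variable R : realType.
Local Notation M := (measurableTypeR R).
Local Notation I01 := (`[0%R, 1%R]%classic : set M).
Local Notation leb := (@lebesgue_measure R).
Local Notation leb2 := (@lebesgue_measure R \x @lebesgue_measure R)%E.

Lemma unit_cube_pair m (x : m.-tuple M) (p q : 'I_m) :
  @unit_cube R m x -> @unit_square R (tnth x p, tnth x q).
Proof. by move=> xC; split; exact: xC. Qed.

Lemma eq_hom_density m (H : sgraph m) (h g : R * R -> R) :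
  (forall z, @unit_square R z -> h z = g z) -> hom_density H h = hom_density H g.
Proof.
move=> hg; apply: eq_Rintegral => x; rewrite inE => xC.
by apply: eq_bigr => e _; rewrite hg//; exact: unit_cube_pair.
Qed.

(** Extending by 0 outside of the square spares conditions on the domain. *)
Lemma graphon_extension (h : R * R -> R) : @graphon R h -> exists g : M * M -> R,
  [/\ measurable_fun setT g, forall z, 0 <= g z <= 1,
      forall x y, g (x, y) = g (y, x) & forall z, @unit_square R z -> h z = g z].
Proof.
move=> [mh h01 hsym]; exists (h \_ (@unit_square R)); split.
- exact: (measurable_restrictT h (@measurable_unit_square R)).1.
- move=> z; rewrite patchE; case: ifPn => [|_]; last by rewrite lexx ler01.
  by rewrite inE; exact: h01.
- move=> x y; rewrite !patchE.
  have -> : ((y, x) \in @unit_square R) = ((x, y) \in @unit_square R).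
    by apply/idP/idP; rewrite !inE => -[].
  by case: ifPn => //; rewrite inE; exact: hsym.
- by move=> z Dz; rewrite patchE mem_set.
Qed.

Lemma hom_density_cst m (H : sgraph m) (u : R) :
  hom_density H (fun=> u) = u ^+ #|edges H|.
Proof.
rewrite /hom_density; under eq_Rintegral do rewrite prodr_const.
exact: (Rintegral_prob_cst (@measurable_unit_cube R m) (lebesgue_unit_cube R m)).
Qed.

Lemma Igraphon_cst (u : R) : Igraphon (fun=> u) = Iscalar u.
Proof.
exact: (Rintegral_prob_cst (@measurable_unit_square R) (@lebesgue_unit_square R)).
Qed.

Lemma measurable_Iscalar : measurable_fun setT (@Iscalar R).
Proof.
apply: measurable_funD; apply: measurable_funM.
- exact: measurable_funM.
- exact: measurable_ln.
- by apply: measurable_funM => //; exact: measurable_funB.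
- by apply: measurableT_comp; [exact: measurable_ln|exact: measurable_funB].
Qed.

Variable g : M * M -> R.
Hypothesis mg : measurable_fun setT g.
Hypothesis g01 : forall z, 0 <= g z <= 1.
Hypothesis gsym : forall x y, g (x, y) = g (y, x).

Local Notation mom E := (\int[leb2]_(z in @unit_square R) g z ^+ E).

Lemma Rintegral_cube_pair m (p q : 'I_m) (f : M * M -> R) : p != q ->
  measurable_fun setT f -> (forall z, 0 <= f z) ->
  \int[lebesgue_tuple R m]_(x in @unit_cube R m) f (tnth x p, tnth x q) =
  \int[leb2]_(z in @unit_square R) f z.
Proof.
move=> pq mf f0; congr fine.
have mf' : measurable_fun setT (EFin \o f) by exact/measurable_EFinP.
rewrite (@cube_integral_pair R m p q (EFin \o f) pq mf')//.
by rewrite -(square_integralE mf').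
Qed.

Section one_graph.
Variables (m : nat) (H : sgraph m).
Hypothesis E0 : (0 < #|edges H|)%N.
Local Notation E := #|edges H|.

(* the defect of AM-GM at a point of the cube *)
Let defect (x : m.-tuple M) : R :=
  (\sum_(e in edges H) g (tnth x e.1, tnth x e.2) ^+ E) / E%:R -
  \prod_(e in edges H) g (tnth x e.1, tnth x e.2).

Let gpow k : measurable_fun setT (fun z => g z ^+ k).
Proof. exact: measurable_funX. Qed.

Let gpow01 k z : 0 <= g z ^+ k <= 1.
Proof. by have /andP[? ?] := g01 z; rewrite exprn_ge0//= exprn_ile1. Qed.

Let mpow (e : 'I_m * 'I_m) :
  measurable_fun setT (fun x : m.-tuple M => g (tnth x e.1, tnth x e.2) ^+ E).
Proof. by apply: measurableT_comp (gpow _) _; exact: measurable_tnth_pair. Qed.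

Let ipow (e : 'I_m * 'I_m) : (lebesgue_tuple R m).-integrable (@unit_cube R m)
  (EFin \o (fun x : m.-tuple M => g (tnth x e.1, tnth x e.2) ^+ E)).
Proof.
apply: (bounded_integrable (@measurable_unit_cube R m) (lebesgue_unit_cube R m) (B := 1)).
  exact: measurable_funTS.
by move=> x _; have /andP[? ?] := gpow01 E (tnth x e.1, tnth x e.2); rewrite ger0_norm.
Qed.

Let prod01g (x : m.-tuple M) : 0 <= \prod_(e in edges H) g (tnth x e.1, tnth x e.2) <= 1.
Proof. exact: prod01. Qed.

Let iprod : (lebesgue_tuple R m).-integrable (@unit_cube R m)
  (EFin \o (fun x : m.-tuple M => \prod_(e in edges H) g (tnth x e.1, tnth x e.2))).
Proof.
apply: (bounded_integrable (@measurable_unit_cube R m) (lebesgue_unit_cube R m) (B := 1)).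
  by apply: measurable_funTS; exact: measurable_hom_prod.
by move=> x _; have /andP[? ?] := prod01g x; rewrite ger0_norm.
Qed.

Let mdefect : measurable_fun setT defect.
Proof.
apply: measurable_funB; last exact: measurable_hom_prod.
apply: measurable_funM => //.
by under eq_fun do rewrite -big_enum; apply: measurable_sum => e; exact: mpow.
Qed.

Let defect01 x : 0 <= defect x <= 1.
Proof.
have [h _] := @leif_prod_mean_powers R _ (edges H)
  (fun e => g (tnth x e.1, tnth x e.2)) E0 (fun e => proj1 (andP (g01 _))).
rewrite subr_ge0 h /= lerBlDr; apply: (@le_trans _ _ 1); last first.
  by rewrite lerDl; have /andP[] := prod01g x.
rewrite ler_pdivrMr ?ltr0n// mul1r -sumr_const; apply: ler_sum => e _.
by have /andP[] := gpow01 E (tnth x e.1, tnth x e.2).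
Qed.

Let edge_neq e : e \in edges H -> e.1 != e.2.
Proof. by move=> /edgesP; apply: contraTneq => ->; rewrite ltnn. Qed.

Let integral_defect :
  \int[lebesgue_tuple R m]_(x in @unit_cube R m) defect x = mom E - hom_density H g.
Proof.
have mC := @measurable_unit_cube R m.
have isum : (lebesgue_tuple R m).-integrable (@unit_cube R m)
    (EFin \o (fun x : m.-tuple M => (\sum_(e in edges H) g (tnth x e.1, tnth x e.2) ^+ E) / E%:R)).
  apply: (bounded_integrable mC (lebesgue_unit_cube R m) (B := 2)).
    apply: measurable_funTS; apply: measurable_funM => //.
    by under eq_fun do rewrite -big_enum; apply: measurable_sum => e; exact: mpow.
  move=> x _; have /andP[d0 d1] := defect01 x; have /andP[p0 p1] := prod01g x.
  rewrite -[X in `|X|](subrK (\prod_(e in edges H) g (tnth x e.1, tnth x e.2))) -/(defect x).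
  by rewrite ger0_norm; lra.
rewrite /defect RintegralB//; congr (_ - _).
rewrite RintegralZr//; last first.
  have := @integrable_sum _ _ _ (lebesgue_tuple R m) (@unit_cube R m) mC _
    (index_enum _) (mem (edges H)) (fun e => EFin \o (fun x : m.-tuple M => g (tnth x e.1, tnth x e.2) ^+ E)) (fun e _ => ipow e).
  by congr (_.-integrable _ _); apply/funext => x /=; rewrite sumEFin.
rewrite (Rintegral_sum mC)//.
rewrite (eq_bigr (fun=> mom E)); last first.
  move=> e eH; rewrite (Rintegral_cube_pair (f := fun z => g z ^+ E) (edge_neq eH))//.
  by move=> z; have /andP[] := gpow01 E z.
by rewrite sumr_const -[X in X / _]mulr_natr mulfK// pnatr_eq0 -lt0n.
Qed.

Lemma hom_density_le_mom : hom_density H g <= mom E.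
Proof.
rewrite -subr_ge0 -integral_defect; apply: Rintegral_ge0 => x _.
by have /andP[] := defect01 x.
Qed.

Lemma hom_density_one_edge : E = 1%N -> hom_density H g = mom E.
Proof.
move=> E1; have /eqP/cards1P[e eE] := E1.
have eH : e \in edges H by rewrite eE inE.
rewrite /hom_density; under eq_Rintegral do rewrite eE big_set1.
rewrite (Rintegral_cube_pair (f := g) (edge_neq eH))//; last first.
  by move=> z; have /andP[] := g01 z.
by apply: eq_Rintegral => z _; rewrite E1.
Qed.

(** As the defect of AM-GM vanishes almost everywhere, g takes the same value on
    all the edges. One of two different edges e and (p, q) has an end q outside of
    the other one. Redrawing q changes the value on (p, q) but not the value on e,
    so g (y, z) = g (y, t) for almost all y, z, t. *)
Lemma hom_density_eq_mom : (1 < E)%N -> hom_density H g = mom E ->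
  exists z0, @unit_square R z0 /\
    {ae leb2, forall z, @unit_square R z -> g z = g z0}.
Proof.
move=> E1 eqE; have mC := @measurable_unit_cube R m.
have ae_edges : {ae lebesgue_tuple R m, forall x, @unit_cube R m x ->
    forall e e', e \in edges H -> e' \in edges H ->
    g (tnth x e.1, tnth x e.2) = g (tnth x e'.1, tnth x e'.2)}.
  have : {ae lebesgue_tuple R m, forall x, @unit_cube R m x -> defect x = 0}.
    apply: (@Rintegral0_ae _ _ _ _ _ mC (lebesgue_unit_cube R m) defect 1).
    - exact: measurable_funTS.
    - by move=> x _; exact: defect01.
    - by rewrite integral_defect eqE subrr.
  apply: ae_weaken => x dx xC e e' eH e'H.
  have [_] := @leif_prod_mean_powers R _ (edges H)
    (fun e => g (tnth x e.1, tnth x e.2)) E0 (fun e => proj1 (andP (g01 _))).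
  move: (dx xC) => /eqP; rewrite subr_eq0 eq_sym => ->.
  by move=> /esym/forall_inP/(_ e eH)/forall_inP/(_ e' e'H)/eqP.
have [e [p [q [eH pq qe ee']]]] : exists e p q, [/\ e \in edges H, p != q,
    (q != e.1) && (q != e.2) &
    {ae lebesgue_tuple R m, forall x, @unit_cube R m x ->
      g (tnth x e.1, tnth x e.2) = g (tnth x p, tnth x q)}].
  have /card_gt1P[e [e' [eH e'H ee']]] := E1.
  have [|] := boolP ((e'.2 != e.1) && (e'.2 != e.2)) => [qe|nq].
    exists e, e'.1, e'.2; split=> //; first exact: edge_neq.
    by apply: ae_weaken ae_edges => x xe xC; exact: xe.
  exists e, e'.2, e'.1; split=> //; first by rewrite eq_sym edge_neq.
    have := edgesP eH; have := edgesP e'H; move: nq ee'.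
    case: e {eH} => a b; case: e' {e'H} => a' b' /=.
    rewrite negb_and !negbK xpair_eqE => nq ee' ab' ab.
    apply/andP; split; apply/eqP => aa; subst a'.
      by case/orP: nq => /eqP bb; subst b'; rewrite ?ltnn ?eqxx// in ab' ee'.
    case/orP: nq => /eqP bb; subst b'; last by rewrite ltnn in ab'.
    by have := ltn_trans ab ab'; rewrite ltnn.
  apply: ae_weaken ae_edges => x xe xC; rewrite (xe xC _ _ eH e'H); exact: gsym.
(* by the triangle inequality through the value on e, the distance between the
   values on (p, q) before and after redrawing q is at most the sum of Delta
   before and after *)
pose Delta (x : m.-tuple M) : \bar R :=
  `|g (tnth x e.1, tnth x e.2) - g (tnth x p, tnth x q)|%:E.
have mDelta : measurable_fun setT Delta.
  apply/measurable_EFinP; apply: measurableT_comp => //.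
  by apply: measurable_funB; apply: measurableT_comp => //; exact: measurable_tnth_pair.
have Delta0 x : (0 <= Delta x)%E by rewrite lee_fin.
have IDelta : (\int[lebesgue_tuple R m]_(x in @unit_cube R m) Delta x = 0)%E.
  rewrite (eq_integral (fun x => `|Delta x|)%E); last by move=> x _; rewrite gee0_abs.
  apply/(ae_eq_integral_abs _ mC); first exact: measurable_funTS.
  by apply: ae_weaken ee' => x xe /xe; rewrite /Delta => ->; rewrite subrr normr0.
apply: symmetric_kernel_constant => //.
pose Q t := (\int[lebesgue_tuple R m]_(x in @unit_cube R m) Delta (upd_tup x q t))%E.
have Q0 : (\int[leb]_(t in I01) Q t = 0)%E.
  by rewrite -IDelta (cube_integral_upd q).
have mupd t : measurable_fun setT (fun x : m.-tuple M => Delta (upd_tup x q t)).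
  by apply: measurableT_comp => //; exact: measurable_upd_tup.
have Kt t : (\int[leb]_(y in I01) \int[leb]_(z in I01) `|g (y, z) - g (y, t)|%:E <= Q t)%E.
  rewrite -(@cube_integral_pair R m p q (fun w => `|g w - g (w.1, t)|%:E) pq); last 2 first.
  - apply/measurable_EFinP; apply: measurableT_comp => //; apply: measurable_funB => //.
    by apply: measurableT_comp => //; exact: measurable_fun_pair.
  - by move=> z; rewrite lee_fin.
  apply: (@le_trans _ _ (\int[lebesgue_tuple R m]_(x in @unit_cube R m) (Delta x + Delta (upd_tup x q t)))%E).
    apply: ge0_le_integral; [exact: mC|by move=> x _; rewrite lee_fin| | |].
    - apply: measurable_funTS; apply/measurable_EFinP; apply: measurableT_comp => //.
      apply: measurable_funB; apply: measurableT_comp => //; first exact: measurable_tnth_pair.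
      by apply: measurable_fun_pair => //; exact: measurable_tnth.
    - by apply: measurable_funTS; exact: emeasurable_funD.
    move=> x _; rewrite /Delta !tnth_mktuple eqxx (negbTE pq) -EFinD lee_fin.
    case/andP: qe => q1 q2; rewrite ![_ == q]eq_sym (negbTE q1) (negbTE q2).
    by rewrite (distrC (g (tnth x e.1, _))) ler_distD.
  rewrite ge0_integralD//; last 2 first.
  - exact: measurable_funTS.
  - exact: measurable_funTS.
  by rewrite IDelta add0e.
apply/eqP; rewrite eq_le; apply/andP; split; last first.
  by do 3 apply: integral_ge0 => ? _; rewrite lee_fin.
have mQ : measurable_fun setT Q.
  apply: (@measurable_partial_integral _ _ M (m.-tuple M) R (lebesgue_tuple R m) _
    (fun w : M * m.-tuple M => Delta (upd_tup w.2 q w.1)) mC).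
    apply: measurableT_comp => //; exact: measurable_upd_tup.
  by move=> w; exact: Delta0.
apply: (@le_trans _ _ (\int[leb]_(t in I01) Q t)%E); last by rewrite Q0.
apply: ge0_le_integral; [exact: measurable_unit_interval| | | |by move=> t _; exact: Kt].
- by move=> t _; do 2 apply: integral_ge0 => ? _; rewrite lee_fin.
- by apply: measurable_funTS; exact: measurable_section_dist.
- exact: measurable_funTS.
Qed.

End one_graph.

(** * The variational problem *)

Section variational_problem.
Variables (k : nat) (m : 'I_k.+1 -> nat).
Variables (H : forall i : 'I_k.+1, sgraph (m i)) (beta : 'I_k.+1 -> R).

Lemma measurable_scalar_fun : measurable_fun setT (scalar_fun H beta).
Proof.
apply: measurable_funB; last exact: measurable_Iscalar.
apply: measurable_sum => i; apply: measurable_funM => //; exact: measurable_funX.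
Qed.

(** For s the scalar supremum, this writes the deficit of g in the variational
    problem as a sum of nonnegative terms: the deficits of the values of g in the
    scalar problem, and the defects of AM-GM with their coefficients; the defect of
    the single edge, whose coefficient may be negative, is zero. *)
Lemma variational_gap (s : R) :
  \int[leb2]_(z in @unit_square R) (s - scalar_fun H beta (g z)) +
    \sum_(i < k.+1) beta i * (mom #|edges (H i)| - hom_density (H i) g)
  = s - (Tfun H beta g - Igraphon g).
Proof.
have mS := @measurable_unit_square R; have lS := @lebesgue_unit_square R.
have ipow e : leb2.-integrable (@unit_square R) (EFin \o (fun z => g z ^+ e)).
  apply: (bounded_integrable mS lS (B := 1)).
    by apply: measurable_funTS; exact: measurable_funX.
  by move=> z _; have /andP[? ?] := g01 z; rewrite ger0_norm ?exprn_ge0// exprn_ile1.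
have ibpow i : leb2.-integrable (@unit_square R)
    (EFin \o (fun z => beta i * g z ^+ #|edges (H i)|)).
  have := integrableZl mS (beta i) (ipow #|edges (H i)|).
  by congr (_.-integrable _ _); apply/funext => z /=; rewrite EFinM.
have iI : leb2.-integrable (@unit_square R) (EFin \o (fun z => Iscalar (g z))).
  apply: (bounded_integrable mS lS (B := 2^-1)).
    by apply: measurable_funTS; apply: measurableT_comp => //; exact: measurable_Iscalar.
  by move=> z _; rewrite ler_norml; have := Iscalar_le0 (g01 z); have := Iscalar_ge (g01 z); lra.
have isum : leb2.-integrable (@unit_square R)
    (EFin \o (fun z => \sum_(i < k.+1) beta i * g z ^+ #|edges (H i)|)).
  have := @integrable_sum _ _ _ leb2 (@unit_square R) mS _ (index_enum _) xpredT
    (fun i => EFin \o (fun z => beta i * g z ^+ #|edges (H i)|)) (fun i _ => ibpow i).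
  by congr (_.-integrable _ _); apply/funext => z /=; rewrite sumEFin.
have isf : leb2.-integrable (@unit_square R) (EFin \o (fun z => scalar_fun H beta (g z))).
  exact: (integrableB mS isum iI).
have icst : leb2.-integrable (@unit_square R) (EFin \o (fun=> s)).
  by apply: (bounded_integrable mS lS (B := `|s|)).
rewrite RintegralB// (Rintegral_prob_cst mS lS) /scalar_fun RintegralB//.
rewrite (Rintegral_sum mS)// -/(Igraphon g).
under eq_bigr do rewrite RintegralZl//.
rewrite /Tfun; under [X in _ + X = _]eq_bigr do rewrite mulrBr.
by rewrite sumrB; ring.
Qed.

End variational_problem.

End graphon_densities.

Lemma edges_complete2 m (H : sgraph m) : m = 2%N -> complete H -> #|edges H| = 1%N.
Proof.
move=> m2; subst m => Hc; apply/eqP/cards1P; exists (ord0, ord_max).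
apply/setP => -[i j]; rewrite !inE /= Hc xpair_eqE.
by case: i => [[|[|//]]] ?; case: j => [[|[|//]]] ?.
Qed.

Section maximizers.
Variables (R : realType) (k : nat) (m : 'I_k.+1 -> nat).
Variables (H : forall i : 'I_k.+1, sgraph (m i)) (beta : 'I_k.+1 -> R).
Local Notation M := (measurableTypeR R).
Local Notation leb2 := (@lebesgue_measure R \x @lebesgue_measure R)%E.
Local Notation S := [set scalar_fun H beta u | u in `[0, 1]%classic].

Lemma scalar_fun_ge u : 0 <= u <= 1 -> - (\sum_(i < k.+1) `|beta i|) <= scalar_fun H beta u.
Proof.
move=> u01; rewrite /scalar_fun -[leLHS]subr0; apply: lerB; last exact: Iscalar_le0.
rewrite -sumrN; apply: ler_sum => i _; rewrite lerNl -mulNr.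
apply: le_trans (ler_norm _) _; rewrite normrM normrN ler_piMr//.
by case/andP: u01 => u0 u1; rewrite ger0_norm ?exprn_ge0// exprn_ile1.
Qed.

(** Here the energy is linear in u, so the scalar functional inherits strict
    concavity from - I: the midpoint of two maximum points would be better. *)
Lemma scalar_fun_max_unique u v s :
  (forall i, beta i != 0 -> #|edges (H i)| = 1%N) ->
  (forall w, 0 <= w <= 1 -> scalar_fun H beta w <= s) ->
  0 <= u <= 1 -> 0 <= v <= 1 -> scalar_fun H beta u = s -> scalar_fun H beta v = s -> u = v.
Proof.
move=> lin ss u01 v01 us vs; apply/eqP/negP => /negP uv.
have linE w : scalar_fun H beta w = (\sum_(i < k.+1) beta i) * w - Iscalar w.
  rewrite /scalar_fun mulr_suml; congr (_ - _); apply: eq_bigr => i _.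
  by have [->|/lin->//] := eqVneq (beta i) 0; rewrite !mul0r.
have := Iscalar_midpoint u01 v01 uv.
have : scalar_fun H beta ((u + v) / 2) <= s by apply: ss; lra.
rewrite linE; move: us vs; rewrite !linE; set c := \sum_(i < _) _ => us vs.
by rewrite mulrA mulrDr; lra.
Qed.

Lemma graphon_cst (u : R) : 0 <= u <= 1 -> graphon (fun=> u).
Proof. by move=> u01; split=> //; exact: measurable_cst. Qed.

Lemma graphon_solution_ge_sup (h : R * R -> R) : graphon_solution H beta h ->
  sup S <= Tfun H beta h - Igraphon h.
Proof.
move=> [_ hmax]; apply: ge_sup; first by exists (scalar_fun H beta 0), 0 => //=; rewrite in_itv/= lexx ler01.
move=> _ [u /= u01 <-]; rewrite in_itv/= in u01.
have := hmax _ (graphon_cst u01); rewrite Igraphon_cst.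
suff -> : Tfun H beta (fun=> u) = \sum_(i < k.+1) beta i * u ^+ #|edges (H i)| by [].
by apply: eq_bigr => i _; rewrite hom_density_cst.
Qed.

Hypothesis H1_edge : #|edges (H ord0)| = 1%N.
Hypothesis H_edge : forall i : 'I_k.+1, (0 < #|edges (H i)|)%N.
Hypothesis beta_ge0 : forall i : 'I_k.+1, i != ord0 -> 0 <= beta i.

(** A maximizer has no deficit, so each term of [variational_gap] vanishes. *)
Lemma graphon_solution_constant (h : R * R -> R) : graphon_solution H beta h ->
  exists u : R, scalar_solution H beta u /\ ae_constant h u.
Proof.
move=> hsol; have [hgr _] := hsol.
have [g [mg g01 gsym hg]] := graphon_extension hgr.
have mS := @measurable_unit_square R; have lS := @lebesgue_unit_square R.
have := graphon_solution_ge_sup hsol.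
have -> : Tfun H beta h = Tfun H beta g.
  by apply: eq_bigr => i _; rewrite (eq_hom_density _ hg).
have -> : Igraphon h = Igraphon g.
  by apply: eq_Rintegral => z; rewrite inE => /hg ->.
rewrite -subr_le0 -(variational_gap mg g01).
set s := sup S; set I := \int[leb2]_(z in _) _.
have ss u : 0 <= u <= 1 -> scalar_fun H beta u <= s by exact: scalar_fun_le_sup.
have I0 : 0 <= I by apply: Rintegral_ge0 => z _; rewrite subr_ge0 ss.
have gap0 i : 0 <= beta i * ((\int[leb2]_(z in @unit_square R) g z ^+ #|edges (H i)|) - hom_density (H i) g).
  have [->|i0] := eqVneq i ord0; last by rewrite mulr_ge0 ?beta_ge0// subr_ge0 hom_density_le_mom.
  by rewrite hom_density_one_edge// subrr mulr0.
move=> le0; have /eqP : I + \sum_(i < k.+1) beta i * ((\int[leb2]_(z in @unit_square R) g z ^+ #|edges (H i)|) - hom_density (H i) g) = 0.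
  by apply/eqP; rewrite eq_le le0 addr_ge0// sumr_ge0.
rewrite paddr_eq0// ?sumr_ge0// => /andP[/eqP I_eq0 /eqP/psumr_eq0P gap_eq0].
have aes : {ae leb2, forall z, @unit_square R z -> s - scalar_fun H beta (g z) = 0}.
  apply: (@Rintegral0_ae _ _ _ leb2 _ mS lS (fun z => s - scalar_fun H beta (g z))
    (s + \sum_(i < k.+1) `|beta i|)) => //.
    apply: measurable_funTS; apply: measurable_funB => //.
    by apply: measurableT_comp => //; exact: measurable_scalar_fun.
  by move=> z _; rewrite subr_ge0 ss//= lerD2l lerNl scalar_fun_ge.
have solution u : 0 <= u <= 1 -> scalar_fun H beta u = s -> scalar_solution H beta u.
  by move=> u01 us; split=> [|v]; rewrite in_itv// us; exact: ss.
have [[i [bi ei]]|lin] := pselect (exists i, beta i != 0 /\ (1 < #|edges (H i)|)%N).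
  have /eqP := gap_eq0 (fun i _ => gap0 i) i isT.
  rewrite mulf_eq0 (negbTE bi)/= subr_eq0 eq_sym => /eqP hmom.
  have [z0 [Dz0 aec]] := hom_density_eq_mom mg g01 gsym (H_edge i) ei hmom.
  exists (g z0); split; last by apply: ae_weaken aec => z gz Dz; rewrite hg// gz.
  have [z [Dz gz sz]] := ae_exists2 mS lS aec aes.
  by apply: solution => //; rewrite -gz; apply/eqP; rewrite eq_sym -subr_eq0 sz.
have lin1 i : beta i != 0 -> #|edges (H i)| = 1%N.
  move=> bi; apply/eqP; rewrite eqn_leq H_edge andbT leqNgt; apply/negP => ei.
  by apply: lin; exists i.
have [z0 Dz0 sz0] := ae_exists mS lS aes.
have gz0 : scalar_fun H beta (g z0) = s by apply/eqP; rewrite eq_sym -subr_eq0 sz0.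
exists (g z0); split; first exact: solution.
apply: ae_weaken aes => z sz Dz; rewrite hg//.
apply: (scalar_fun_max_unique lin1 ss) => //.
by apply/eqP; rewrite eq_sym -subr_eq0 sz.
Qed.

End maximizers.

Theorem theorem4p1 (R : realType) (k : nat) (m : 'I_k.+1 -> nat)
    (H : forall i : 'I_k.+1, sgraph (m i)) (beta : 'I_k.+1 -> R)
    (H1_order : m ord0 = 2%N) (H1_complete : complete (H ord0))
    (H_edge : forall i : 'I_k.+1, (0 < #|edges (H i)|)%N)
    (beta_ge0 : forall i : 'I_k.+1, i != ord0 -> 0 <= beta i) :
  (psi H beta n @[n --> \oo] -->
     sup [set scalar_fun H beta u | u in `[0, 1]%classic]) /\
  (forall h : R * R -> R, graphon_solution H beta h ->
     exists u : R, scalar_solution H beta u /\ ae_constant h u).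
Proof.
have H1_edge := edges_complete2 H1_order H1_complete.
split; first exact: psi_cvg.
by move=> h; exact: graphon_solution_constant.
Qed.
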